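(* Let $\Gamma$ be the dual graph of a divisorial valuation of the projective plane which is not the $\mathfrak m$-adic one, let $\{\bar\beta_i\}_{i=0}^{g+1}$ be its sequence of maximal contact values (which depends only on $\Gamma$), and assume that $\bar\beta_1^2\ge\bar\beta_{g+1}$. Then a very general valuation $\nu\in\mathcal V_\Gamma$ satisfies $\hat\mu(\nu)\le\bar\beta_1$. If, in addition, the set $$A_\nu:=\{a\in\mathbb Z\mid 1\le a\le\lfloor\bar\beta_1/\bar\beta_0\rfloor\ \text{and}\ a^2\bar\beta_0^2\ge\bar\beta_{g+1}\}$$ is not empty, then a very general $\nu\in\mathcal V_\Gamma$ satisfies $\hat\mu(\nu)\le\bar\beta_0\cdot\min(A_\nu)$.
   Context: **Valuations.** $\mathbf{k}$ is an algebraically closed field of arbitrary characteristic, $\mathbb{P}^2=\mathbb{P}^2_{\mathbf{k}}$ has projective coordinates $(X:Y:Z)$, $p=(1:0:0)$, $u=Y/X$, $v=Z/X$, $R=\mathcal{O}_{\mathbb{P}^2,p}$ with maximal ideal $\mathfrak m$, and $K$ is the fraction field of $R$. Valuations are valuations $\nu$ of $K$ centered at $R$ (i.e. $\nu\ge 0$ on $R$ and $\{f\in R:\nu(f)>0\}\cup\{0\}=\mathfrak m$). Such a $\nu$ is *divisorial* if rank, rational rank and transcendence degree (of its residue field over $\mathbf k$) are all $1$. To $\nu$ divisorial corresponds a finite sequence of point blow-ups $X_s\xrightarrow{\pi_s}X_{s-1}\to\cdots\to X_0=\mathrm{Spec}\,R$, where $\pi_1$ is the blow-up of $p_1=\mathfrak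 m$, $E_i$ is the exceptional divisor of $\pi_i$, $\pi_{i+1}$ is the blow-up of $X_i$ at the closed point $p_{i+1}\in E_i$ at which $\nu$ is centered, and $\nu=\mathrm{ord}_{E_s}$; $\mathcal C_\nu=\{p_i\}_{i=1}^s$. The *dual graph* of $\nu$ has one vertex for each $E_i$, labelled $i$, with two vertices joined iff the corresponding (strict transforms of the) divisors meet, and an arrow attached to the vertex of $E_s$. The $\mathfrak m$-adic valuation is the case $s=1$. For a positive integer $d$, $\mu_d(\nu)=\max\{\nu(f): 0\ne f\in\mathbf{k}[u,v],\ \deg f\le d\}$, and $\hat\mu(\nu)=\lim_{d\to\infty}\mu_d(\nu)/d$. **Hamburger–Noether expansion.** If $\nu(u)\le\nu(v)$, the Hamburger–Noether expansion of the divisorial valuation $\nu$ in $(u,v)$ is the finite system of equalities (with $w_{-1}=v$, $w_0=u$, $s_0=0<s_1<\dots<s_g$, $k_0=1$) $$w_{s_j-1}=\sum_{i=k_j}^{h_{s_j}}a_{s_ji}w_{s_j}^i+w_{s_j}^{h_{s_j}}w_{s_j+1}\ (0\le j\le g),\qquad w_{i-1}=w_i^{h_i}w_{i+1}\ (0<i<s_g,\ i\notin\{s_1,\dots,s_g\}),$$ with $a_{s_ji}\in\mathbf{k}$, obtained by repeatedly dividing $w_{i-1}$ by $w_i$ and subtracting a constant so as to get regular parameters at the successive centers of $\nu$, until the remainder $w_{i+1}$ has $\nu(w_{i+1})<\nu(w_i)$; if $\nu(w_{i+1})>0$ one continues with the pair $(w_i,w_{i+1})$, and if $\nu(w_{i+1})=0$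 the procedure ends. Rows having nonzero coefficients (and the first row) are called free; $a_{s_jk_j}\ne0$ for $1\le j\le g-1$, and for $j=g$ if that row is free. The row $j=g$ is the last one, $\nu(w_{s_g+1})=0$, and either this row is free or all its coefficients vanish and $k_g=h_{s_g}$. **Maximal contact values.** With $e_j=\nu(w_{s_j})$, $n_0=1$, $n_j=e_{j-1}/e_j$ ($j\ge1$): $\bar\beta_0=e_0=\nu(\mathfrak m)$ and $\bar\beta_{j+1}=n_j\bar\beta_j+(h_{s_j}-k_j)e_j+\nu(w_{s_j+1})$ for $0\le j\le g$. **Very general valuations.** The dual graph $\Gamma$ is equivalent to the structure of the expansion (everything but the values of the coefficients in the free rows). $\mathcal V_\Gamma$ is the set of valuations (with $\nu(u)\le\nu(v)$) with dual graph $\Gamma$; their expansions differ only in the coefficients $a_{0i}$ ($1\le i\le h_0$) and $a_{s_ji}$ ($1\le j\le g'$, $k_j\le i\le h_{s_j}$), where $g'=g$ if the row $j=g$ is free and $g'=g-1$ otherwise. Thus $\mathcal V_\Gamma$ is identified with the closed points of the Zariski-open subset $\mathcal U_\Gamma=\{a_{s_jk_j}\neq 0,\ 1\le j\le g'\}$ of $\mathbb A^{b(\Gamma)}_{\mathbf k}$, $b(\Gamma)=h_0+\sum_{j=1}^{g'}(h_{s_j}-k_j+1)$. A property holds for a *very general* valuation in $\mathcal V_\Gamma$ if there is a countable collection of nonempty Zariski-open subsets of $\mathcal U_\Gamma$ such that it holds for every valuation in their intersection. *)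

(* Defs.v *)
(* The file mpoly must be imported before the analysis files, otherwise their
   notations clash. *)
From HB Require Import structures.
From mathcomp Require Import all_boot all_order all_algebra.
From mathcomp Require Import mpoly.
From mathcomp Require Import classical_sets reals topology normedtype sequences.

Set Implicit Arguments.
Unset Strict Implicit.
Unset Printing Implicit Defensive.

Import Order.TTheory GRing.Theory Num.Theory.
Import numFieldNormedType.Exports.

Local Open Scope classical_set_scope.
Local Open Scope ring_scope.

Section FunctionField.
Variable k : closedFieldType.

Definition polyUV := {mpoly k[2]}.
Definition ratUV := {fraction polyUV}.
Notation K := ratUV.

Definition toK (f : polyUV) : K := FracField.tofrac f.
Definition cstK (c : k) : K := toK c%:MP.
Definition uK : K := toK 'X_(ord0 : 'I_2).
Definition vK : K := toK 'X_(ord_max : 'I_2).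

(* P(t_0, ..., t_{n-1}) *)
Definition evalK (n : nat) (t : 'I_n -> K) (P : {mpoly k[n]}) : K :=
  mmap cstK t P.

Definition evalK2 (xy : K * K) (P : {mpoly k[2]}) : K :=
  evalK (fun i : 'I_2 => if i == ord0 then xy.1 else xy.2) P.

(** Local rings of closed points.  The local ring of P^2 at p is
    k[u,v]_(u,v), and the local ring of a closed point infinitely near to p is
    k[x,y]_(x,y) for regular parameters x, y obtained from (u,v) by the
    successive substitutions of [blowup_point] below; such a pair is
    algebraically independent over k, with k(x,y) = K.  The three
    definitions that follow are meant for such pairs. *)

(* z belongs to k[x,y]_(x,y) *)
Definition in_locring (xy : K * K) (z : K) : Prop :=
  exists f g : {mpoly k[2]},
    g@_0%MM != 0 /\ z * evalK2 xy g = evalK2 xy f.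

(* z belongs to the maximal ideal of k[x,y]_(x,y) *)
Definition in_locmax (xy : K * K) (z : K) : Prop :=
  exists f g : {mpoly k[2]},
    [/\ g@_0%MM != 0, f@_0%MM = 0 & z * evalK2 xy g = evalK2 xy f].

(* f lies in the n-th power of the ideal (X_0, X_1) *)
Definition mord_ge (n : nat) (f : {mpoly k[2]}) : bool :=
  all (fun m => (n <= mdeg m)%N) (msupp f).

(* z belongs to the valuation ring of ord_E, where E is the exceptional divisor
   of the blow-up of the point with parameters x, y: z = f(x,y) / g(x,y) with
   ord f >= n = ord g for some n. *)
Definition in_ordring (xy : K * K) (z : K) : Prop :=
  exists (f g : {mpoly k[2]}) (n : nat),
    [/\ mord_ge n f, mord_ge n g && ~~ mord_ge n.+1 g &
        z * evalK2 xy g = evalK2 xy f].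

(* The closed points of the exceptional divisor of the blow-up of the point with
   parameters x, y, each one given by a pair of parameters:
   (x, y/x - c) with c in k, and (x/y, y). *)
Definition blowup_point (xy q : K * K) : Prop :=
  (exists c : k, q = (xy.1, xy.2 / xy.1 - cstK c)) \/
  q = (xy.1 / xy.2, xy.2).

(** Divisorial valuations, normalised so that the value group is Z.  The value
    [nu 0] is irrelevant: every condition is restricted to nonzero elements. *)

Definition valuation (nu : K -> int) : Prop :=
  (forall x y, x != 0 -> y != 0 -> nu (x * y) = nu x + nu y) /\
  (forall x y, x != 0 -> y != 0 -> x + y != 0 ->
     Num.min (nu x) (nu y) <= nu (x + y)).

Definition centered (nu : K -> int) (xy : K * K) : Prop :=
  forall z, z != 0 -> in_locring xy z ->
    0 <= nu z /\ (0 < nu z <-> in_locmax xy z).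

(* The t_i lie in the valuation ring and their residues are algebraically
   independent over k. *)
Definition res_indep (nu : K -> int) (n : nat) (t : 'I_n -> K) : Prop :=
  (forall i, t i != 0 -> 0 <= nu (t i)) /\
  (forall P : {mpoly k[n]}, P != 0 -> evalK t P != 0 /\ nu (evalK t P) = 0).

Definition res_trdeg (nu : K -> int) (n : nat) : Prop :=
  (exists t : 'I_n -> K, res_indep nu t) /\
  ~ (exists t : 'I_n.+1 -> K, res_indep nu t).

Definition divisorial (nu : K -> int) : Prop :=
  [/\ valuation nu, (exists2 x, x != 0 & nu x = 1),
      centered nu (uK, vK) & res_trdeg nu 1].

(* nu is ord_E, E being the exceptional divisor of the blow-up of the point with
   parameters x, y. *)
Definition is_ord (nu : K -> int) (xy : K * K) : Prop :=
  forall (f : {mpoly k[2]}) (n : nat),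
    mord_ge n f -> ~~ mord_ge n.+1 f -> nu (evalK2 xy f) = n%:Z.

Definition m_adic (nu : K -> int) : Prop := is_ord nu (uK, vK).

(** Dual graphs.  The vertices are 0, ..., s-1 instead of 1, ..., s; the arrow
    is attached to the last vertex. *)

Record dual_graph := DualGraph { dg_size : nat; dg_adj : rel 'I_dg_size }.

(* [pts i] is a pair of parameters at the center of the blow-up with exceptional
   divisor E_i, for i < s.  A closed point of X_s is a point of the
   exceptional divisor of one of the blow-ups that is not blown up later, and
   it lies on the strict transform of E_i if and only if its local ring is
   contained in the valuation ring of ord_{E_i}. *)
Definition has_dual_graph (nu : K -> int) (G : dual_graph) : Prop :=
  exists pts : nat -> K * K,
  [/\ (0 < dg_size G)%N,
      pts 0%N = (uK, vK),
      (forall i, (i.+1 < dg_size G)%N -> blowup_point (pts i) (pts i.+1)),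
      (forall i, (i < dg_size G)%N -> centered nu (pts i)) &
      is_ord nu (pts (dg_size G).-1) /\
      forall i j : 'I_(dg_size G),
        dg_adj i j <->
        i != j /\
        exists q : K * K,
          [/\ (exists l : nat, [/\ (l < dg_size G)%N, blowup_point (pts l) q &
                 (l.+1 < dg_size G)%N -> q <> pts l.+1]),
              (forall z, in_locring q z -> in_ordring (pts i) z) &
              (forall z, in_locring q z -> in_ordring (pts j) z)]].

(* The set V_Gamma *)
Definition valuations_with_graph (G : dual_graph) (nu : K -> int) : Prop :=
  [/\ divisorial nu, nu uK <= nu vK & has_dual_graph nu G].

(* The structure of an expansion: everything but the coefficients of the free
   rows.  Only s_j and k_j for j <= g and h_i for i <= s_g matter. *)
Record hn_structure := HNStructure {
  hn_g : nat;
  hn_s : nat -> nat;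
  hn_h : nat -> nat;
  hn_k : nat -> nat;
  hn_lastfree : bool (* whether the row j = g is free *)
}.

Section Structure.
Variable S : hn_structure.
Notation g := (hn_g S).
Notation s := (hn_s S).
Notation h := (hn_h S).
Notation kk := (hn_k S).

(* The first row is free, so a non-free last row requires g >= 1. *)
Definition hn_wf : Prop :=
  [/\ s 0%N = 0%N,
      (forall j, (j < g)%N -> (s j < s j.+1)%N),
      kk 0%N = 1%N,
      (forall j, (j <= g)%N -> (kk j <= h (s j))%N) &
      hn_lastfree S \/ ((0 < g)%N /\ kk g = h (s g))].

(* g' *)
Definition hn_g' : nat := if hn_lastfree S then g else g.-1.

(* Number of coefficients of the free row j; it is h_0 for j = 0. *)
Definition hn_len (j : 'I_hn_g'.+1) : nat := (h (s j) - kk j).+1.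

(* b(Gamma); the coefficient a_{s_j, k_j + i} is the coordinate of index
   [tagnat.Rank j i]. *)
Definition hn_b : nat := \sum_(j < hn_g'.+1) hn_len j.

Definition hn_coef (a : 'I_hn_b -> k) (j : 'I_hn_g'.+1) (i : 'I_(hn_len j)) : k :=
  a (tagnat.Rank j i).

(* U_Gamma *)
Definition hn_U : set ('I_hn_b -> k) :=
  [set a | forall j : 'I_hn_g'.+1, (0 < j)%N -> @hn_coef a j ord0 != 0].

(* Indices of the w's are shifted by one: [w i.+1] is w_i and [w 0] is w_{-1}.
   The last condition expresses that the procedure ends: w_{s_g+1} has value 0
   and no constant can be subtracted from it to continue.  The coefficient of
   w_{s_g}^{h_{s_g}} in a free last row is then not determined by nu. *)
Definition hn_expansion (nu : K -> int) (a : 'I_hn_b -> k) (w : nat -> K) : Prop :=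
  [/\ hn_wf /\ hn_U a,
      w 0%N = vK /\ w 1%N = uK,
      [/\ (forall j : 'I_hn_g'.+1,
             w (s j) =
               \sum_(i < hn_len j)
                  cstK (@hn_coef a j i) * w (s j).+1 ^+ (kk j + i)
               + w (s j).+1 ^+ h (s j) * w (s j).+2),
          (~~ hn_lastfree S ->
             w (s g) = w (s g).+1 ^+ h (s g) * w (s g).+2) &
          (forall i, (0 < i < s g)%N ->
             (forall j, (j <= g)%N -> i <> s j) ->
             w i = w i.+1 ^+ h i * w i.+2)],
      (forall i, (i <= s g)%N -> w i.+1 != 0 /\ 0 < nu (w i.+1)) /\
      (forall i, (i <= s g)%N -> w i.+2 != 0 /\ nu (w i.+2) < nu (w i.+1)) &
      nu (w (s g).+2) = 0 /\
      forall c : k, w (s g).+2 - cstK c != 0 /\ nu (w (s g).+2 - cstK c) = 0].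

Section MaximalContact.
Variables (nu : K -> int) (w : nat -> K).

Definition hn_e (j : nat) : int := nu (w (s j).+1).

Definition hn_n (j : nat) : int :=
  if j is j'.+1 then (hn_e j' %/ hn_e j)%Z else 1.

Fixpoint max_contact (j : nat) : int :=
  if j is j'.+1 then
    hn_n j' * max_contact j' + (h (s j') - kk j')%:Z * hn_e j'
      + nu (w (s j').+2)
  else hn_e 0.

(* The set A_nu *)
Definition in_A (a : nat) : bool :=
  [&& (1 <= a)%N,
      a%:Z <= (max_contact 1 %/ max_contact 0)%Z &
      max_contact g.+1 <= a%:Z ^+ 2 * max_contact 0 ^+ 2].

End MaximalContact.

Definition zariski_open (b : nat) (O : set ('I_b -> k)) : Prop :=
  exists F : set {mpoly k[b]}, O = [set a | exists2 f, F f & f.@[a] != 0].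

(* A property of the valuations in V_Gamma, the coordinates on V_Gamma being the
   coefficients of the expansions of structure S; S is meant to be the structure
   determined by the dual graph G.  A countable family of open sets is given as a
   sequence, possibly with repetitions. *)
Definition very_general (G : dual_graph) (P : (K -> int) -> Prop) : Prop :=
  exists O : nat -> set ('I_hn_b -> k),
    (forall n, [/\ zariski_open (O n), O n `<=` hn_U & O n !=set0]) /\
    (forall (nu : K -> int) (a : 'I_hn_b -> k) (w : nat -> K),
       valuations_with_graph G nu -> hn_expansion nu a w ->
       (forall n, O n a) -> P nu).

End Structure.

(* mu_d(nu) = m; note that msize f = deg f + 1 for f != 0 *)
Definition is_mu (nu : K -> int) (d : nat) (m : int) : Prop :=
  (exists f : polyUV, [/\ f != 0, (msize f <= d.+1)%N & nu (toK f) = m]) /\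
  (forall f : polyUV, f != 0 -> (msize f <= d.+1)%N -> nu (toK f) <= m).

(* mu_d(nu) exists for every d > 0 and mu_d(nu) / d converges to l. *)
Definition is_hat_mu (R : realType) (nu : K -> int) (l : R) : Prop :=
  exists2 mu : nat -> int,
    (forall d, (0 < d)%N -> is_mu nu d (mu d)) &
    (fun d : nat => (mu d)%:~R / d%:R : R) @ \oo --> l.

Definition hat_mu_le (R : realType) (c : R) (nu : K -> int) : Prop :=
  exists2 l : R, is_hat_mu nu l & l <= c.

End FunctionField.

Arguments uK {k}.
Arguments vK {k}.
Arguments very_general k S G P : clear implicits.

(* Main.v *)
Require Import Defs.
From HB Require Import structures.
From mathcomp Require Import all_boot all_order all_algebra.
From mathcomp Require Import mpoly.
From mathcomp Require generic_quotient.
From mathcomp Require Import classical_sets reals topology normedtype sequences.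
From mathcomp Require Import zify ring lra.

Set Implicit Arguments.
Unset Strict Implicit.
Unset Printing Implicit Defensive.

Import Order.TTheory GRing.Theory Num.Theory.
Local Open Scope ring_scope.

(** Write x and z for w_{s_g} and w_{s_g+1}.  The rows express u and v as
    polynomials in x and z whose coefficients are polynomials in the
    coefficients of the rows; as nu(x) = 1 and the residue of z is
    transcendental, nu is the order with respect to x on k[x,z].  So, for given
    d and n, the property that nu(f) <= n for all nonzero f of degree at most d
    says that finitely many vectors, depending polynomially on the coefficients
    of the rows, are linearly independent: it is open ([small_order_open]).  By
    [very_general_hat_mu] one point of U_Gamma where it holds for all d with
    n = d b is enough for the bound b on very general valuations.

    That point is obtained from the given expansion by changing the first row
    only: its coefficients are replaced by 0, or by those of u^A where
    A = min A_nu.  This amounts to keeping nu and replacing v by v' or by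
    u^A + v', where v' is u^{h_0} w_1; the new element v1 satisfies
    k[u,v1] = k[u,v] and nu(v1) = b with b = beta_1 or b = A beta_0, so that
    beta_{g+1} <= b^2 in both cases.  It remains to see that nu(f) <= d b for
    every polynomial f of degree at most d in u and v1.

    This holds for v1 itself, and for f not divisible by v1 it follows from
    nu(f) b <= d beta_{g+1}, an inequality between an intersection number and
    values ([coprime_value_bound]).  It comes from two estimates of the
    dimension of k[u,v1] modulo the ideal of the elements of value at least m.
    Let D <= d be the degree of f(u,0).  Dividing by v1 and f shows that the
    products f^i v1^j u^l with l < D and i nu(f) + j b < m generate, whence the
    upper bound D m^2 / (2 nu(f) b) up to lower order terms ([spanning]).  The
    lower bound m^2 / (2 beta_{g+1}) is given by elements of k[u,v1] with
    independent initial forms ([independence]).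

    Those elements are constructed row by row, without key polynomials.  In
    terms of x_j = w_{s_j} and z_j = w_{s_j+1}, the ring k[u,v1] has an element
    with initial form x_j^alpha z_j^beta as soon as alpha >= N_j beta + c for
    some constant c, where N_0 = h_0.  A block of monomial rows replaces N by
    n (N n + n') ([poly_forms_monomial]) and the next free row adds h - k to it
    ([monomial_forms_free]).  This is the recursion of the maximal contact
    values, and at the end N_g = beta_{g+1} ([generic_forms_expansion]). *)

(** * Polynomials in two elements of a field *)

Section Subalgebra.
Variables (k K : fieldType) (iota : {rmorphism k -> K}).

(** The subring k[x,t] of K. *)
Inductive alg2 (x t : K) : K -> Prop :=
| Alg2C c : alg2 x t (iota c)
| Alg2X : alg2 x t x
| Alg2T : alg2 x t t
| Alg2D z1 z2 : alg2 x t z1 -> alg2 x t z2 -> alg2 x t (z1 + z2)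
| Alg2M z1 z2 : alg2 x t z1 -> alg2 x t z2 -> alg2 x t (z1 * z2).

Definition ev1 (t : K) (p : {poly k}) : K := (map_poly iota p).[t].

Fact ev1_is_zmod_morphism t : zmod_morphism (ev1 t).
Proof. by move=> p q; rewrite /ev1 rmorphB hornerD hornerN. Qed.
Fact ev1_is_monoid_morphism t : monoid_morphism (ev1 t).
Proof.
by split=> [|p q]; rewrite /ev1 ?rmorph1 ?hornerC // rmorphM hornerM.
Qed.
HB.instance Definition _ t :=
  GRing.isZmodMorphism.Build {poly k} K (ev1 t) (ev1_is_zmod_morphism t).
HB.instance Definition _ t :=
  GRing.isMonoidMorphism.Build {poly k} K (ev1 t) (ev1_is_monoid_morphism t).

Lemma ev1C t c : ev1 t c%:P = iota c.
Proof. by rewrite /ev1 map_polyC hornerC. Qed.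

Lemma ev1X t : ev1 t 'X = t.
Proof. by rewrite /ev1 map_polyX hornerX. Qed.

Lemma ev1_monomial t c i : ev1 t (c *: 'X^i) = iota c * t ^+ i.
Proof. by rewrite -mul_polyC rmorphM rmorphXn /= ev1C ev1X. Qed.

Section Closure.
Variables x t : K.
Local Notation B := (alg2 x t).

Lemma alg2_0 : B 0. Proof. by rewrite -(rmorph0 iota); exact: Alg2C. Qed.
Lemma alg2_1 : B 1. Proof. by rewrite -(rmorph1 iota); exact: Alg2C. Qed.

Lemma alg2N z : B z -> B (- z).
Proof.
by move=> Bz; rewrite -mulN1r -(rmorph1 iota) -rmorphN; apply: Alg2M (Alg2C _ _ _) Bz.
Qed.

Lemma alg2B z1 z2 : B z1 -> B z2 -> B (z1 - z2).
Proof. by move=> B1 B2; apply: Alg2D => //; apply: alg2N. Qed.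

Lemma alg2X z n : B z -> B (z ^+ n).
Proof.
move=> Bz; elim: n => [|n IHn]; first by rewrite expr0; exact: alg2_1.
by rewrite exprS; exact: Alg2M.
Qed.

Lemma alg2_sum (I : finType) (Q : pred I) (F : I -> K) :
  (forall i, Q i -> B (F i)) -> B (\sum_(i | Q i) F i).
Proof.
move=> BF; apply: (big_ind B) => //; first exact: alg2_0.
by move=> *; apply: Alg2D.
Qed.

Lemma alg2_ev1 p : B (ev1 t p).
Proof.
elim/poly_ind: p => [|p c IHp]; first by rewrite rmorph0; exact: alg2_0.
by rewrite rmorphD rmorphM /= ev1X ev1C; apply/Alg2D/Alg2C/Alg2M/Alg2T.
Qed.

Lemma alg2_trans y1 y2 z : B y1 -> B y2 -> alg2 y1 y2 z -> B z.
Proof.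
move=> B1 B2; elim=> // [c|z1 z2 _ ? _ ?|z1 z2 _ ? _ ?].
- exact: Alg2C.
- exact: Alg2D.
- exact: Alg2M.
Qed.

(** Division by x: the remainder is a polynomial in t. *)
Lemma alg2_split z : B z -> exists p z', B z' /\ z = ev1 t p + x * z'.
Proof.
elim=> [c|||z1 z2 _ [p1 [y1 [B1 ->]]] _ [p2 [y2 [B2 ->]]]
          |z1 z2 _ [p1 [y1 [B1 ->]]] _ [p2 [y2 [B2 ->]]]].
- by exists c%:P, 0; split; [exact: alg2_0 | rewrite ev1C mulr0 addr0].
- by exists 0, 1; split; [exact: alg2_1 | rewrite rmorph0 mulr1 add0r].
- by exists 'X, 0; split; [exact: alg2_0 | rewrite ev1X mulr0 addr0].
- exists (p1 + p2), (y1 + y2); split; first exact: Alg2D.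
  by rewrite rmorphD /=; ring.
- exists (p1 * p2), (ev1 t p1 * y2 + y1 * ev1 t p2 + x * y1 * y2); split.
    apply: Alg2D; last by do 2 apply: Alg2M => //; exact: Alg2X.
    by apply: Alg2D; apply: Alg2M => //; apply: alg2_ev1.
  by rewrite rmorphM /=; ring.
Qed.

Lemma alg2_pow_add s T n : B s -> B T ->
  exists2 T', B T' & (s + x * T) ^+ n = s ^+ n + x * T'.
Proof.
move=> Bs BT; elim: n => [|n [T' BT' IHn]].
  by exists 0; [exact: alg2_0 | rewrite mulr0 addr0].
exists (s * T' + T * s ^+ n + x * T * T').
  by repeat (apply: Alg2D || apply: Alg2M || apply: alg2X || apply: Alg2X || by []).
by rewrite exprS IHn exprS; ring.
Qed.

End Closure.

(** The outer variable is sent to x, the inner one to t. *)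
Definition ev2 (x t : K) (f : {poly {poly k}}) : K := (map_poly (ev1 t) f).[x].

Fact ev2_is_zmod_morphism x t : zmod_morphism (ev2 x t).
Proof. by move=> p q; rewrite /ev2 rmorphB hornerD hornerN. Qed.
Fact ev2_is_monoid_morphism x t : monoid_morphism (ev2 x t).
Proof.
by split=> [|p q]; rewrite /ev2 ?rmorph1 ?hornerC // rmorphM hornerM.
Qed.
HB.instance Definition _ x t :=
  GRing.isZmodMorphism.Build {poly {poly k}} K (ev2 x t)
    (ev2_is_zmod_morphism x t).
HB.instance Definition _ x t :=
  GRing.isMonoidMorphism.Build {poly {poly k}} K (ev2 x t)
    (ev2_is_monoid_morphism x t).

Lemma ev2C x t p : ev2 x t p%:P = ev1 t p.
Proof. by rewrite /ev2 map_polyC hornerC. Qed.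

Lemma ev2X x t : ev2 x t 'X = x.
Proof. by rewrite /ev2 map_polyX hornerX. Qed.

Lemma alg2_ev2 x t f : alg2 x t (ev2 x t f).
Proof.
elim/poly_ind: f => [|f c IHf]; first by rewrite rmorph0; exact: alg2_0.
rewrite rmorphD rmorphM /= ev2X ev2C.
by apply: Alg2D; [apply: Alg2M => //; exact: Alg2X | exact: alg2_ev1].
Qed.

Lemma ev2_split x t (f : {poly {poly k}}) e : (forall i, (i < e)%N -> f`_i = 0) ->
  exists2 y, alg2 x t y & ev2 x t f = x ^+ e * (ev1 t f`_e + x * y).
Proof.
move=> f_e; exists (ev2 x t (drop_poly e.+1 f)); first exact: alg2_ev2.
rewrite -{1}(poly_take_drop e.+1 f).
have -> : take_poly e.+1 f = (f`_e)%:P * 'X^e.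
  apply/polyP => i; rewrite coef_take_poly coefCM coefXn.
  case: (ltngtP i e) => [ie|ie|->].
  - by rewrite ltnW // f_e // mulr0.
  - by rewrite ltnS leqNgt ie mulr0.
  - by rewrite ltnSn mulr1.
by rewrite rmorphD !rmorphM !rmorphXn /= !ev2X ev2C exprS; ring.
Qed.

Lemma alg2_sym x t z : alg2 x t z -> alg2 t x z.
Proof. by apply: alg2_trans; [exact: Alg2T | exact: Alg2X]. Qed.

End Subalgebra.

(** * Initial forms along the rows of an expansion *)

Section InitialForms.
Variables (k K : fieldType) (iota : {rmorphism k -> K}).
Local Notation alg2 := (alg2 iota).
Local Notation ev1 := (ev1 iota).
Variables u v : K.
Local Notation P := (alg2 u v).

(** The ring k[u,v] contains elements with initial form x^al z^be, up to a
    constant, in the cone al >= N be + c.  The terms divisible by x^(al + I)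
    become negligible for every monomial weight once I is large. *)
Definition monomial_forms (x z : K) (N : nat) : Prop :=
  exists c : nat, forall al be I : nat, (N * be + c <= al)%N ->
  exists kap G1 G2 G3, [/\ kap != 0, alg2 x z G1, alg2 x z G2, alg2 x z G3 &
    P (x ^+ al * z ^+ be * (iota kap + x * G1 + z * G2) + x ^+ (al + I) * G3)].

(** Here t has value 0: in order la with respect to x, the leading coefficients
    fill the product of a power of t and the polynomials of degree at most b, for
    all b up to about la / M. *)
Definition poly_forms (x t : K) (M : nat) : Prop :=
  exists c : nat, forall la b : nat, (M * b + c <= la)%N ->
  exists q : nat, forall p : {poly k}, (size p <= b.+1)%N ->
  exists2 G, alg2 x t G & P (x ^+ la * (t ^+ q * ev1 t p + x * G)).

(** In order la with respect to x, about la / N leading coefficients of distinct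
    orders in z. *)
Definition generic_forms (x z : K) (N : nat) : Prop :=
  exists c : nat, forall la b : nat, (N * b + c <= la)%N ->
  exists q : nat, forall i : nat, (i <= b)%N ->
  exists kap G2 G3, [/\ kap != 0, alg2 x z G2, alg2 x z G3 &
    P (x ^+ la * (z ^+ (q + i) * (iota kap + z * G2) + x * G3))].

Lemma poly_forms_of_powers x t la q b :
  (forall i, (i <= b)%N -> exists kap G, [/\ kap != 0, alg2 x t G &
     P (x ^+ la * (iota kap * t ^+ (q + i) + x * G))]) ->
  forall p : {poly k}, (size p <= b.+1)%N ->
  exists2 G, alg2 x t G & P (x ^+ la * (t ^+ q * ev1 t p + x * G)).
Proof.
move=> pw p szp.
have -> : p = \sum_(i < b.+1) p`_i *: 'X^i.
  apply/polyP => i; rewrite coef_sum.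
  have [ib|bi] := ltnP i b.+1.
    rewrite (bigD1 (Ordinal ib)) //= coefZ coefXn eqxx mulr1 big1 ?addr0 // => j.
    by rewrite coefZ coefXn -val_eqE /= eq_sym => /negbTE ->; rewrite mulr0.
  rewrite nth_default ?(leq_trans szp) // big1 // => j _.
  by rewrite coefZ coefXn; case: eqP => [ij|]; rewrite ?mulr0 //; have := ltn_ord j; lia.
elim/big_ind: _ => [|p1 p2 [G1 B1 P1] [G2 B2 P2]|i _].
- exists 0; first exact: alg2_0.
  by rewrite rmorph0 !mulr0 addr0 mulr0; exact: alg2_0.
- exists (G1 + G2); first exact: Alg2D.
  by have := Alg2D P1 P2; congr P; rewrite rmorphD /=; ring.
- have [kap [G [kap0 BG PG]]] := pw i (ltn_ord i).
  exists (iota (p`_i / kap) * G); first by apply/Alg2M/BG/Alg2C.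
  have := Alg2M (Alg2C _ _ _ (p`_i / kap)) PG; congr P.
  rewrite ev1_monomial exprD rmorphM fmorphV.
  have : iota kap != 0 by rewrite fmorph_eq0.
  by move=> ?; field.
Qed.

(** The determinant condition provides an inverse of n' modulo n. *)
Lemma monomial_exponents n n' B D la :
  (0 < n)%N -> (0 < n')%N -> (n * D = n' * B + 1 \/ n' * B = n * D + 1)%N ->
  (n * n' <= la)%N ->
  exists al be, [/\ (be < n)%N & (n * al + n' * be = la)%N].
Proof.
move=> n0 n'0 det laL.
suff [s [q Es]] : exists s q, (n' * s = q * n + 1)%N.
  pose be := ((la * s) %% n)%N.
  have ben : (be < n)%N by rewrite ltn_mod.
  have nbe : (n' * be <= la)%N.
    by apply: leq_trans laL; rewrite mulnC leq_mul2r ltnW ?orbT.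
  exists ((la - n' * be) %/ n)%N, be; split => //.
  suff /divnK : (n %| la - n' * be)%N by lia.
  rewrite -eqn_mod_dvd // eq_sym.
  rewrite /be modnMmr mulnCA Es mulnDr muln1 mulnA modnMDl //.
case: det => det; last by exists B, D; lia.
case: n n0 det {laL} => // -[|m] _ det; first by exists 1%N, n'.-1; lia.
exists (B * m.+1)%N, (D * m.+1 - 1)%N.
have D0 : (0 < D)%N by case: D det => // det; lia.
by nia.
Qed.

(** The monomials of value la in xj and zj form a progression of direction
    (- n', n), along which the exponent of t changes by 1 or by - 1 at each step,
    since n D - n' B = 1 or - 1.  The conditions defining the cone leave about
    la / (n (N n + n')) consecutive exponents. *)
Lemma poly_forms_monomial xj zj x t N n n' B D :
  xj = x ^+ n * t ^+ B -> zj = x ^+ n' * t ^+ D ->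
  (0 < n)%N -> (0 < n')%N ->
  (n * D = n' * B + 1 \/ n' * B = n * D + 1)%N ->
  monomial_forms xj zj N -> poly_forms x t (n * (N * n + n')).
Proof.
move=> Ex Ez n0 n'0 det [c monf].
have Bx : alg2 x t xj.
  by rewrite Ex; apply: Alg2M; apply: alg2X; [apply: Alg2X|apply: Alg2T].
have Bz : alg2 x t zj.
  by rewrite Ez; apply: Alg2M; apply: alg2X; [apply: Alg2X|apply: Alg2T].
have form al be : (N * be + c <= al)%N ->
    exists kap G, [/\ kap != 0, alg2 x t G &
      P (x ^+ (n * al + n' * be) * (iota kap * t ^+ (B * al + D * be) + x * G))].
  (* The exponent n (al + I) exceeds n al + n' be as soon as I > n' be. *)
  move=> alL; have [kap [G1 [G2 [G3 [kap0 B1 B2 B3 Pf]]]]] :=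
    monf al be (n' * be).+1 alL.
  exists kap, (t ^+ (B * al + D * be) *
    (x ^+ n.-1 * t ^+ B * G1 + x ^+ n'.-1 * t ^+ D * G2) +
    x ^+ (n * (n' * be).+1 - (n' * be).+1) * t ^+ (B * (al + (n' * be).+1)) * G3).
  split=> //.
    have T := @alg2_trans _ _ _ _ _ _ _ _ Bx Bz.
    by repeat (apply: Alg2D || apply: Alg2M || apply: alg2X ||
               apply: Alg2X || apply: Alg2T || apply: T || by []).
  move: Pf; congr P; rewrite Ex Ez.
  rewrite !exprMn -!exprM.
  set W := (n' * be)%N.
  have -> : (n * (al + W.+1) = n * al + W + 1 + (n * W.+1 - W.+1))%N by nia.
  case: n n0 {Ex det} => // n _; case: n' n'0 {Ez} @W => // n' _ W /=.
  by rewrite mulnDr !exprD !exprS -/W; ring.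
exists (n * (n' + N * n + c))%N => la b laL.
have [al [be [ben Ela]]] : exists al be, [/\ (be < n)%N & (n * al + n' * be = la)%N].
  by apply: (monomial_exponents n0 n'0 det); nia.
have alL : ((N * n + n') * b + N * n + c <= al)%N.
  rewrite -(leq_pmul2l n0); nia.
have step i : (i <= b)%N ->
    exists kap G, [/\ kap != 0, alg2 x t G &
     P (x ^+ la * (iota kap * t ^+ (B * (al - n' * i) + D * (be + n * i)) + x * G))].
  move=> ib; have nib : (n' * i <= al)%N by nia.
  have <- : (n * (al - n' * i) + n' * (be + n * i) = la)%N.
    by rewrite -Ela mulnBr; nia.
  by apply: form; nia.
case: det => det.
  exists (B * al + D * be)%N; apply: poly_forms_of_powers => i ib.
  have := step i ib; set e := (X in t ^+ X).
  suff -> : e = (B * al + D * be + i)%N by [].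
  rewrite /e mulnBr mulnDr; have nib : (n' * i <= al)%N by nia.
  by nia.
have nib i : (i <= b)%N -> (n' * i <= al)%N by nia.
exists (B * (al - n' * b) + D * (be + n * b))%N.
apply: poly_forms_of_powers => i ib.
have := step (b - i)%N (leq_subr _ _); set e := (X in t ^+ X).
suff -> : e = (B * (al - n' * b) + D * (be + n * b) + i)%N by [].
rewrite /e; have := nib b (leqnn b); have -> : b = (i + (b - i))%N by lia.
by rewrite addKn => ?; nia.
Qed.

(** Subtracting elements of higher order removes, order by order, everything that
    is not divisible by the b-th power of s = t - a - x T. *)
Lemma poly_forms_vanishing x t M a s T : a != 0 ->
  alg2 x t T -> t = iota a + s + x * T -> poly_forms x t M ->
  exists c : nat, forall la b : nat, (M * b + c <= la)%N ->
  exists q : nat, forall I : nat,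
  exists G1 G2, [/\ alg2 x t G1, alg2 x t G2 &
    P (x ^+ la * (t ^+ q * s ^+ b + x * s ^+ b * G1 + x ^+ I.+1 * G2))].
Proof.
move=> a0 BT Et [c polyf]; exists c => la b laL.
have Bs : alg2 x t s.
  have -> : s = t - iota a - x * T by rewrite Et; ring.
  by apply: alg2B; [apply: alg2B; [apply: Alg2T|apply: Alg2C] |
                    apply: Alg2M => //; apply: Alg2X].
have [T' BT' ET'] := alg2_pow_add b Bs BT.
pose w : {poly k} := ('X - a%:P) ^+ b.
have szw : size w = b.+1 by rewrite /w size_exp_XsubC.
have Ew : ev1 t w = s ^+ b + x * T'.
  rewrite rmorphXn rmorphB /= ev1X ev1C -ET'.
  by congr (_ ^+ b); rewrite [X in X - _]Et; ring.
have [q qf] := polyf la b laL; exists q; elim=> [|I [G1 [G2 [B1 B2 Pf]]]].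
  have [|G BG PG] := qf w; first by rewrite szw.
  exists 0, (t ^+ q * T' + G); split; first exact: alg2_0.
    apply: Alg2D => //; apply: Alg2M => //; apply: alg2X; exact: Alg2T.
  by move: PG; congr P; rewrite Ew; ring.
have [p2 [G3 [B3 E2]]] := alg2_split B2.
have [|q' qf'] := polyf (la + I.+1)%N b; first by lia.
(* As a <> 0, X^q' is invertible modulo w = (X - a)^b: the remainder of the next
   coefficient modulo w can be cancelled by an element of order la + I + 1. *)
have cop : coprimep ('X^q') w.
  rewrite /w coprimep_expl // coprimep_expr //.
  by rewrite coprimep_XsubC rootX.
have [[u1 u2] /= Bez] : exists u, u.1 * 'X^q' + u.2 * w = 1.
  have /Bezout_eq1_coprimepP[uu ?] := cop; by exists uu.
pose r := (p2 * u1) %% w.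
pose Q := (p2 * u1) %/ w * 'X^q' + p2 * u2.
have Ep2 : p2 = Q * w + 'X^q' * r.
  rewrite /Q /r -[LHS]mulr1 -Bez.
  have E := divp_eq (p2 * u1) w.
  rewrite mulrDr !mulrA {1}E; ring.
have szr : (size r <= b.+1)%N.
  rewrite -szw ltnW // ltn_modp -size_poly_eq0 szw //.
have [G' BG' PG'] := qf' r szr.
exists (G1 + x ^+ I * ev1 t Q), (G3 - G' + ev1 t Q * T'); split.
- apply: Alg2D => //; apply: Alg2M; last exact: alg2_ev1.
  by apply: alg2X; apply: Alg2X.
- apply: Alg2D; first exact: alg2B.
  by apply: Alg2M => //; exact: alg2_ev1.
have := alg2B Pf PG'; congr P.
have EX : ev1 t 'X^q' = t ^+ q' by rewrite rmorphXn /= ev1X.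
rewrite E2 Ep2 rmorphD 2!rmorphM /= EX Ew.
rewrite exprD !exprS; ring.
Qed.

(** Taking s = x^r z in [poly_forms_vanishing], an element of order la gives the
    monomial x^(la + r b) z^b: the slope increases by r. *)
Lemma monomial_forms_free x z t M r a T : a != 0 ->
  alg2 x t T -> alg2 x z T -> t = iota a + x ^+ r * z + x * T ->
  poly_forms x t M -> monomial_forms x z (M + r).
Proof.
move=> a0 BT BT' Et polyf.
have Bt : alg2 x z t.
  rewrite Et; repeat (apply: Alg2D || apply: Alg2M || apply: alg2X ||
               apply: Alg2X || apply: Alg2T || apply: Alg2C || by []).
have sub := @alg2_trans _ _ _ _ _ _ _ _ (Alg2X _ _ _) Bt.
have [c cf] := poly_forms_vanishing a0 BT Et polyf.
exists c => al be I alL.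
have [|q qf] := cf (al - r * be)%N be; first by nia.
have [G1 [G2 [B1 B2 Pf]]] := qf (r * be + I)%N.
have [G3 [G4 [B3 B4 Eq]]] : exists G3 G4, [/\ alg2 x z G3, alg2 x z G4 &
    t ^+ q = iota (a ^+ q) + x * G3 + z * G4].
  elim: q {qf Pf} => [|q [G3 [G4 [B3 B4 E]]]].
    exists 0, 0; rewrite !expr0 rmorph1 !mulr0 !addr0.
    by split => //; exact: alg2_0.
  exists (t * G3 + T * iota (a ^+ q)), (t * G4 + x ^+ r * iota (a ^+ q)).
  split; try by repeat (apply: Alg2D || apply: Alg2M || apply: alg2X ||
               apply: Alg2X || apply: Alg2T || apply: Alg2C || by []).
  rewrite exprS E exprS rmorphM /=.
  transitivity ((iota a + x ^+ r * z + x * T) * iota (a ^+ q) +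
    x * (t * G3) + z * (t * G4)); first by rewrite -Et; ring.
  by ring.
exists (a ^+ q), (G3 + G1), G4, (x * G2); split.
- by rewrite expf_eq0 (negbTE a0) andbF.
- by apply: Alg2D => //; apply: sub.
- by [].
- by apply: Alg2M; [apply: Alg2X | apply: sub].
move: Pf; congr P; rewrite Eq.
have -> : (al + I = (al - r * be) + r * be + I)%N by nia.
have -> : x ^+ al = x ^+ (al - r * be) * x ^+ (r * be).
  by rewrite -exprD; congr (_ ^+ _); nia.
by rewrite exprMn -exprM exprS !exprD; ring.
Qed.

Lemma generic_forms_free x z N : monomial_forms x z N -> generic_forms x z N.
Proof.
move=> [c cf]; exists c => la b laL; exists 0%N => i ib.
have [|kap [G1 [G2 [G3 [kap0 B1 B2 B3 Pf]]]]] := cf la i 1%N; first by nia.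
exists kap, G2, (z ^+ i * G1 + G3); split => //.
  apply: Alg2D => //; apply: Alg2M => //; apply: alg2X; exact: Alg2T.
by move: Pf; congr P; rewrite add0n exprD; ring.
Qed.

(** The case of a last row without coefficients, where t is z itself. *)
Lemma generic_forms_satellite x z N : poly_forms x z N -> generic_forms x z N.
Proof.
move=> [c cf]; exists c => la b laL; have [q qf] := cf la b laL.
exists q => i ib; have [|G BG PG] := qf 'X^i; first by rewrite size_polyXn.
exists 1, 0, G; split; rewrite ?oner_eq0 //; first exact: alg2_0.
by move: PG; congr P; rewrite rmorphXn rmorph1 /= ev1X exprD; ring.
Qed.

End InitialForms.

(** * Valuations and order with respect to a parameter *)

Section Valuations.
Variables (k K : fieldType) (iota : {rmorphism k -> K}) (nu : K -> int).
Hypothesis nuM : forall x y, x != 0 -> y != 0 -> nu (x * y) = nu x + nu y.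
Hypothesis nuD : forall x y, x != 0 -> y != 0 -> x + y != 0 ->
  Num.min (nu x) (nu y) <= nu (x + y).
Hypothesis nuC : forall c, c != 0 -> nu (iota c) = 0.

Lemma nu1 : nu 1 = 0.
Proof. by have := nuC (oner_neq0 k); rewrite rmorph1. Qed.

Lemma nuN x : x != 0 -> nu (- x) = nu x.
Proof.
move=> x0; rewrite -mulN1r nuM ?oppr_eq0 ?oner_eq0 //.
have /nuC : - 1 != 0 :> k by rewrite oppr_eq0 oner_eq0.
by rewrite rmorphN rmorph1 => ->; rewrite add0r.
Qed.

Lemma nuX x n : x != 0 -> nu (x ^+ n) = n%:Z * nu x.
Proof.
move=> x0; elim: n => [|n IHn]; first by rewrite expr0 nu1 mul0r.
by rewrite exprS nuM ?expf_neq0 // IHn; lia.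
Qed.

(** The inequality m <= nu z for the convention nu 0 = +oo. *)
Definition vge (m : int) (z : K) : Prop := z = 0 \/ m <= nu z.

Lemma vge0 m : vge m 0. Proof. by left. Qed.

Lemma vge_le m n z : m <= n -> vge n z -> vge m z.
Proof. by move=> mn [->|nz]; [left|right; exact: le_trans mn nz]. Qed.

Lemma vge_nu z : vge (nu z) z. Proof. by right. Qed.

Lemma vgeD m x y : vge m x -> vge m y -> vge m (x + y).
Proof.
move=> [->|mx]; first by rewrite add0r.
move=> [->|my]; first by rewrite addr0; right.
have [->|x0] := eqVneq x 0; first by rewrite add0r; right.
have [->|y0] := eqVneq y 0; first by rewrite addr0; right.
have [->|xy0] := eqVneq (x + y) 0; first by left.
by right; apply: le_trans (nuD x0 y0 xy0); rewrite le_min mx.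
Qed.

Lemma vgeM m n x y : vge m x -> vge n y -> vge (m + n) (x * y).
Proof.
move=> [->|mx]; first by rewrite mul0r; left.
move=> [->|my]; first by rewrite mulr0; left.
have [->|x0] := eqVneq x 0; first by rewrite mul0r; left.
have [->|y0] := eqVneq y 0; first by rewrite mulr0; left.
by right; rewrite nuM // lerD.
Qed.

Lemma vgeC c : vge 0 (iota c).
Proof.
have [->|c0] := eqVneq c 0; first by left; rewrite rmorph0.
by right; rewrite nuC.
Qed.

Lemma vgeX m x n : vge m x -> vge (n%:Z * m) (x ^+ n).
Proof.
move=> mx; elim: n => [|n IHn]; first by right; rewrite expr0 nu1 mul0r.
by rewrite exprS; apply: vge_le (vgeM mx IHn); lia.
Qed.

Lemma vge_sum (I : finType) (Q : pred I) (F : I -> K) m :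
  (forall i, Q i -> vge m (F i)) -> vge m (\sum_(i | Q i) F i).
Proof.
move=> vF; apply: (big_ind (vge m)) => //; first exact: vge0.
exact: vgeD.
Qed.

Lemma vge_alg2 x t z : vge 0 x -> vge 0 t -> alg2 iota x t z -> vge 0 z.
Proof.
move=> vx vt; elim=> // [c|z1 z2 _ v1 _ v2|z1 z2 _ v1 _ v2].
- exact: vgeC.
- exact: vgeD.
- by rewrite -(addr0 0); exact: vgeM.
Qed.

(** Ultrametric equality. *)
Lemma nu_add_gt x y : x != 0 -> vge (nu x + 1) y ->
  x + y != 0 /\ nu (x + y) = nu x.
Proof.
move=> x0 [->|xy]; first by rewrite addr0.
have [->|y0] := eqVneq y 0; first by rewrite addr0.
have xy0 : x + y != 0.
  apply/eqP => /eqP; rewrite addr_eq0 => /eqP Ex.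
  by move: xy; rewrite Ex nuN //; lia.
split=> //; have := nuD x0 y0 xy0.
have Ny0 : - y != 0 by rewrite oppr_eq0.
have := nuD xy0 Ny0; rewrite addrK nuN // => /(_ x0).
lia.
Qed.

Lemma nu_monomial x t m q : x != 0 -> t != 0 -> nu t = 0 ->
  nu (x ^+ m * t ^+ q) = m%:Z * nu x.
Proof.
by move=> x0 t0 nt; rewrite nuM ?expf_neq0 // !nuX // nt mulr0 addr0.
Qed.

Section GenericPair.
Variables x z : K.
Hypotheses (x0 : x != 0) (nux : 0 < nu x).
Hypothesis nuz : forall p, p != 0 -> ev1 iota z p != 0 /\ nu (ev1 iota z p) = 0.

Lemma vge_ev1 p : vge 0 (ev1 iota z p).
Proof.
have [->|p0] := eqVneq p 0; first by left; rewrite rmorph0.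
by right; case: (nuz p0) => _ ->.
Qed.

Lemma vge_generic y : alg2 iota x z y -> vge 0 y.
Proof.
apply: vge_alg2; first by right; apply: ltW.
by have := vge_ev1 'X; rewrite ev1X.
Qed.

(** A nonzero polynomial in z has value 0, so it dominates a multiple of x. *)
Lemma nu_leading p y la : p != 0 -> alg2 iota x z y ->
  x ^+ la * (ev1 iota z p + x * y) != 0 /\
  nu (x ^+ la * (ev1 iota z p + x * y)) = la%:Z * nu x.
Proof.
move=> p0 By; have [z0 nz] := nuz p0.
have [//|s0 ns] := @nu_add_gt (ev1 iota z p) (x * y) z0.
  rewrite nz; apply: vge_le (vgeM (vge_nu x) (vge_generic By)); lia.
by rewrite mulf_neq0 ?expf_neq0 // nuM ?expf_neq0 // nuX // ns nz addr0.
Qed.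

Lemma nu_ev2_le (f : {poly {poly k}}) i n : f`_i != 0 -> (i <= n)%N ->
  nu (ev2 iota x z f) <= n%:Z * nu x.
Proof.
move=> fi ni; have [|e fe emin] := @ex_minnP (fun e => f`_e != 0); first by exists i.
have [|y By ->] := @ev2_split _ _ iota x z f e.
  by move=> j je; apply/eqP; apply: contraLR je => /emin; rewrite -leqNgt.
have [_ ->] := nu_leading e fe By.
by apply: ler_wpM2r; [exact: ltW | rewrite lez_nat (leq_trans (emin _ fi))].
Qed.

Lemma vge_ev2 (f : {poly {poly k}}) n : (forall i, (i < n)%N -> f`_i = 0) ->
  vge (n%:Z * nu x) (ev2 iota x z f).
Proof.
move=> f0; have [y By ->] := ev2_split iota x z f0.
rewrite -[_ * nu x]addr0; apply: vgeM; first exact/vgeX/vge_nu.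
apply: vge_generic; apply: Alg2D; first exact: alg2_ev1.
by apply: Alg2M => //; exact: Alg2X.
Qed.

(** On k[x,z], nu is nu(x) times the order with respect to x. *)
Lemma nu_generic_dvd y : alg2 iota x z y -> y != 0 -> (nu x %| nu y)%Z.
Proof.
move=> By y0; have : 0 <= nu y.
  by case: (vge_generic By) => // /eqP; rewrite (negbTE y0).
case En: (nu y) => [n|//] _; elim/ltn_ind: n => n IHn in y By y0 En *.
have [p [y' [By' Ey]]] := alg2_split By.
have [p0|p0] := eqVneq p 0; last first.
  have [_] := nu_leading 0 p0 By'; rewrite expr0 !mul1r -Ey mul0r En => ->.
  exact: dvdz0.
move: Ey; rewrite p0 rmorph0 add0r => Ey.
have y'0 : y' != 0 by apply: contraNneq y0 => y'0; rewrite Ey y'0 mulr0.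
have En' : nu y = nu x + nu y' by rewrite Ey nuM.
have : 0 <= nu y' by case: (vge_generic By') => // /eqP; rewrite (negbTE y'0).
case Ey': (nu y') => [n'|//] _.
have /dvdzP[q Eq] : (nu x %| n'%:Z)%Z.
  by apply: (IHn _ _ _ By' y'0 Ey'); clear - En En' Ey' nux; lia.
by apply/dvdzP; exists (q + 1); rewrite -En En' Ey' Eq; ring.
Qed.

End GenericPair.
End Valuations.

Section ResiduallyTranscendental.
Variables (k : closedFieldType) (K : fieldType) (iota : {rmorphism k -> K}).
Variable nu : K -> int.
Hypothesis nuM : forall x y, x != 0 -> y != 0 -> nu (x * y) = nu x + nu y.
Hypothesis nuC : forall c, c != 0 -> nu (iota c) = 0.

(** Over an algebraically closed field it suffices to test linear polynomials. *)
Lemma residually_transcendental (z : K) :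
  (forall c, z - iota c != 0 /\ nu (z - iota c) = 0) ->
  forall p, p != 0 -> ev1 iota z p != 0 /\ nu (ev1 iota z p) = 0.
Proof.
move=> zc p p0; have [r Ep] := closed_field_poly_normal p.
have lp0 : iota (lead_coef p) != 0 by rewrite fmorph_eq0 lead_coef_eq0.
rewrite Ep -mul_polyC rmorphM rmorph_prod /= ev1C.
suff [r0 nr] : \prod_(i <- r) ev1 iota z ('X - i%:P) != 0 /\
    nu (\prod_(i <- r) ev1 iota z ('X - i%:P)) = 0.
  by rewrite mulf_neq0 // nuM // nuC ?lead_coef_eq0 // add0r.
elim: r {Ep} => [|c r [r0 nr]].
  by rewrite big_nil oner_neq0 (nu1 nuC).
rewrite big_cons rmorphB /= ev1X ev1C; have [c0 nc] := zc c.
by rewrite mulf_neq0 // nuM // nc nr.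
Qed.

End ResiduallyTranscendental.

Lemma linear_dependence (k : fieldType) (I J : finType) (A : I -> J -> k) :
  (#|J| < #|I|)%N ->
  exists c : I -> k, (exists i, c i != 0) /\ forall j, \sum_i c i * A i j = 0.
Proof.
move=> JI; pose M : 'M[k]_(#|I|, #|J|) := \matrix_(i, j) A (enum_val i) (enum_val j).
have : kermx M != 0.
  rewrite kermx_eq0 /row_free; apply: contraTneq JI => <-.
  by rewrite -leqNgt rank_leq_col.
case/rowV0Pn => r /sub_kermxP rM r0.
exists (fun i => r 0 (enum_rank i)); split.
  apply/existsP; apply: contraNT r0; rewrite negb_exists => /forallP r0.
  apply/eqP/rowP => i; rewrite mxE.
  by have := r0 (enum_val i); rewrite negbK enum_valK => /eqP.
move=> j; have /rowP/(_ (enum_rank j)) := rM; rewrite mxE [RHS]mxE.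
rewrite (reindex (@enum_rank I)) /=; last exact/onW_bij/enum_rank_bij.
by under eq_bigr do rewrite mxE !enum_rankK.
Qed.

(** The index set for the pairs (i, j) with i + j < n, read as (i + j, i), and for
    families of sizes 1, ..., n. *)
Notation triangle n := {q : 'I_n & 'I_q.+1}.

Lemma card_triangle n : (2 * #|{: triangle n}| = n * n.+1)%N.
Proof.
rewrite card_tagged sumnE big_map big_enum /=.
under eq_bigr do rewrite card_ord.
elim: n => [|n IHn]; first by rewrite big_ord0.
rewrite big_ord_recr mulnDr /= IHn; nia.
Qed.

(** * Counting dimensions modulo a valuation ideal *)

Section Counting.
Variables (k K : fieldType) (iota : {rmorphism k -> K}) (nu : K -> int).
Hypothesis nuM : forall x y, x != 0 -> y != 0 -> nu (x * y) = nu x + nu y.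
Hypothesis nuD : forall x y, x != 0 -> y != 0 -> x + y != 0 ->
  Num.min (nu x) (nu y) <= nu (x + y).
Hypothesis nuC : forall c, c != 0 -> nu (iota c) = 0.
Variables u v : K.
Local Notation P := (alg2 iota u v).
Local Notation vge := (vge nu).

Section Spanning.
Variables (f f1 : K) (pf : {poly k}) (F b : nat).
Hypotheses (Ef : f = ev1 iota u pf + v * f1) (Pf1 : P f1) (pf0 : pf != 0).
Hypotheses (F0 : (0 < F)%N) (b0 : (0 < b)%N).
Hypotheses (vu : vge 0 u) (vv : vge b%:Z v) (vf : vge F%:Z f).
Local Notation D := (size pf).-1.

(** The products f^i v^j u^l such that the sum of the quotients of i by b and of j
    by F is less than n.  They include those with i F + j b < n F b, and their
    number is F b D n (n + 1) / 2. *)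
Definition span_gen n (t : triangle n * 'I_b * 'I_F * 'I_D) : K :=
  f ^+ (b * tagged t.1.1.1 + t.1.1.2) *
  v ^+ (F * (tag t.1.1.1 - tagged t.1.1.1) + t.1.2) * u ^+ t.2.

Lemma span_gen_ex n i j l : (i * F + j * b < n * F * b)%N -> (l < D)%N ->
  exists t, @span_gen n t = f ^+ i * v ^+ j * u ^+ l.
Proof.
move=> ijn lD.
have Ei := divn_eq i b; have Ej := divn_eq j F.
have lq : (i %/ b + j %/ F < n)%N.
  have hi := leq_mul (leq_trunc_div i b) (leqnn F).
  have hj := leq_mul (leq_trunc_div j F) (leqnn b).
  rewrite -(ltn_pmul2r F0) -(ltn_pmul2r b0); apply: leq_ltn_trans ijn.
  by apply: leq_trans (leq_add hi hj); rewrite !mulnDl leq_add // mulnAC.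
have li : (i %/ b < (i %/ b + j %/ F).+1)%N by rewrite ltnS leq_addr.
have ri : (i %% b < b)%N by rewrite ltn_mod.
have rj : (j %% F < F)%N by rewrite ltn_mod.
pose t : triangle n := Tagged (fun q : 'I_n => 'I_q.+1)
  (Ordinal li : 'I_(Ordinal lq).+1).
exists (t, Ordinal ri, Ordinal rj, Ordinal lD); rewrite /span_gen /= addKn.
by rewrite mulnC -Ei mulnC -Ej.
Qed.

(** Any y in k[u,v] is f y1 + v y2 + r(u) with deg r < D, by division by v and
    then by pf.  Iterating on y1 and y2 raises the value by F and b. *)
Lemma spanning n g : P g ->
  exists cf, vge (n * F * b)%:Z (g - \sum_t iota (cf t) * @span_gen n t).
Proof.
pose m := (n * F * b)%N.
pose Sp g := exists cf : _ -> k, vge m%:Z (g - \sum_t iota (cf t) * @span_gen n t).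
have SpD y1 y2 : Sp y1 -> Sp y2 -> Sp (y1 + y2).
  move=> [c1 v1] [c2 v2]; exists (fun t => c1 t + c2 t).
  under eq_bigr do rewrite rmorphD mulrDl.
  by rewrite big_split opprD addrACA; apply: vgeD.
have SpZ c y : Sp y -> Sp (iota c * y).
  move=> [c1 v1]; exists (fun t => c * c1 t).
  under eq_bigr do rewrite rmorphM -mulrA.
  rewrite -mulr_sumr -mulrBr -[m%:Z]add0r; apply: vgeM => //; exact: vgeC.
have Sp_vge y : vge m%:Z y -> Sp y.
  by move=> vy; exists (fun=> 0); rewrite big1 ?subr0 // => t _; rewrite rmorph0 mul0r.
have Sp_gen t : Sp (@span_gen n t).
  exists (fun t' => (t' == t)%:R); rewrite (bigD1 t) //= eqxx rmorph1 mul1r.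
  rewrite big1 => [|t' /negbTE ->]; last by rewrite rmorph0 mul0r.
  by rewrite addr0 subrr; left.
have vP y : P y -> vge 0 y.
  by apply: (vge_alg2 nuM nuD nuC) => //; apply: vge_le vv.
suff main r : forall i j y, (m - (i * F + j * b) <= r)%N -> P y ->
    Sp (f ^+ i * v ^+ j * y).
  by move=> Pg; have := main m 0%N 0%N g; rewrite !mul1r; apply; rewrite ?leq_subr.
have big_ij i j y : (m <= i * F + j * b)%N -> P y -> Sp (f ^+ i * v ^+ j * y).
  move=> ij Py; apply: Sp_vge.
  apply: (@vge_le _ _ _ (i%:Z * F%:Z + j%:Z * b%:Z + 0)); first by lia.
  by apply: vgeM => //; [apply: vgeM => //; apply: (vgeX nuM nuC) | apply: vP].
elim: r => [|r IHr] i j y.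
  by move=> ij Py; apply: big_ij => //; lia.
have [ij _ Py|ij rL Py] := leqP m (i * F + j * b); first exact: big_ij.
have [p [y2 [/alg2_sym Py2 Ey]]] := alg2_split (alg2_sym Py).
have Ep := divp_eq p pf.
have -> : f ^+ i * v ^+ j * y =
    f ^+ i.+1 * v ^+ j * ev1 iota u (p %/ pf) +
    f ^+ i * v ^+ j.+1 * (y2 - f1 * ev1 iota u (p %/ pf)) +
    f ^+ i * v ^+ j * ev1 iota u (p %% pf).
  have Epf : ev1 iota u pf = f - v * f1 by rewrite [in RHS]Ef addrK.
  rewrite Ey {1}Ep rmorphD rmorphM /= Epf !exprS; ring.
apply: (SpD); first apply: (SpD).
- by apply: IHr; [nia | exact/alg2_sym/alg2_ev1].
- apply: IHr; first by nia.
  by apply: alg2B => //; apply: Alg2M => //; exact/alg2_sym/alg2_ev1.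
have szr : (size (p %% pf)%R <= D)%N.
  by rewrite -ltnS prednK ?size_poly_gt0 // ltn_modp.
set rem := (p %% pf)%R in szr *.
have -> : rem = \sum_(l < D) rem`_l *: 'X^l.
  rewrite -poly_def; apply/polyP => l; rewrite coef_poly.
  by case: ltnP => // Dl; rewrite nth_default // (leq_trans szr).
rewrite rmorph_sum mulr_sumr.
apply: (big_ind Sp) => //; first by apply: Sp_vge; left.
move=> l _; rewrite /= ev1_monomial.
have [t Et] := span_gen_ex ij (ltn_ord l).
by rewrite mulrCA -Et; apply: SpZ.
Qed.

End Spanning.

Section Independence.
Variables x z : K.
Hypotheses (x0 : x != 0) (nux : nu x = 1).
Hypothesis nuz : forall p, p != 0 -> ev1 iota z p != 0 /\ nu (ev1 iota z p) = 0.

(** In the element of index (q, i, r) the order with respect to x is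
    c + N q + r and the leading coefficient is the i-th of a family of size
    q + 1. *)
Lemma independence N : generic_forms iota u v x z N ->
  exists c : nat, forall n, exists e : triangle n * 'I_N -> K,
  (forall t, P (e t)) /\
  forall cf : triangle n * 'I_N -> k, (exists t, cf t != 0) ->
    ~ vge (c + N * n)%:Z (\sum_t iota (cf t) * e t).
Proof.
move=> [c gen]; exists c => n.
pose la (a : 'I_n * 'I_N) := (c + N * a.1 + a.2)%N.
pose row (t : triangle n * 'I_N) := (tag t.1, t.2).
pose deg (t : triangle n * 'I_N) := nat_of_ord (tagged t.1).
have la_inj a1 a2 : la a1 = la a2 -> a1 = a2.
  case: a1 a2 => q1 r1 [q2 r2]; rewrite /la /= => E.
  have E' : (q1 * N + r1 = q2 * N + r2)%N by lia.
  have Er : r1 = r2 :> nat.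
    by have := congr1 (modn^~ N) E'; rewrite !modnMDl !modn_small.
  congr (_, _); apply: val_inj => //=.
  have N0 : (0 < N)%N by apply: leq_ltn_trans (ltn_ord r1).
  by apply/eqP; rewrite -(eqn_pmul2r N0); apply/eqP; lia.
have row_inj t1 t2 : row t1 = row t2 -> deg t1 = deg t2 -> t1 = t2.
  case: t1 t2 => [[q1 i1] r1] [[q2 i2] r2] [/= Eq Er] Ei.
  move: Eq i2 Ei; rewrite /tag /= => <- i2; rewrite /deg /= => Ei.
  by rewrite Er; congr (existT _ _ _, _); apply: val_inj.
have [q Hq] : exists q : 'I_n * 'I_N -> nat, forall (a : 'I_n * 'I_N) i,
    (i <= a.1)%N -> exists kap G2 G3,
    [/\ kap != 0, alg2 iota x z G2, alg2 iota x z G3 &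
    P (x ^+ la a * (z ^+ (q a + i) * (iota kap + z * G2) + x * G3))].
  have gen_a (a : 'I_n * 'I_N) : (N * a.1 + c <= la a)%N by rewrite /la; lia.
  exact: fin_all_exists (fun a => gen _ _ (gen_a a)).
pose form t y := exists kap G2 G3,
    [/\ kap != 0, alg2 iota x z G2, alg2 iota x z G3 &
    y = x ^+ la (row t) * (z ^+ (q (row t) + deg t) * (iota kap + z * G2) + x * G3)].
have [e He] : exists e : triangle n * 'I_N -> K, forall t, P (e t) /\ form t (e t).
  suff ex_e t : exists y, P y /\ form t y by exact: fin_all_exists ex_e.
  case: (Hq (row t) (deg t)); first by rewrite -ltnS ltn_ord.
  move=> kap [G2 [G3 [kap0 B2 B3 Pf]]].
  by eexists; split; first exact: Pf; exists kap, G2, G3.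
exists e; split=> [t|cf cf0]; first by case: (He t).
have deg_lt t : (deg t < n)%N.
  by apply: leq_trans (ltn_ord (tag t.1)); rewrite ltnS -ltnS ltn_ord.
(* The dominant term: least value, then least degree in z. *)
pose weight t := (la (row t) * n + deg t)%N.
have [t0 c0 t0min] : exists2 t0, cf t0 != 0 &
    forall t, cf t != 0 -> (weight t0 <= weight t)%N.
  case: cf0 => t1 c1; case: (arg_minnP (P := fun t => cf t != 0) weight c1) => t0 ? ?.
  by exists t0.
pose L := la (row t0); pose Q := (q (row t0) + deg t0)%N.
have [kap [G2 [G3 [kap0 B2 B3 E0]]]] := (He t0).2.
have Bz i : alg2 iota x z (z ^+ i) by apply/alg2X/Alg2T.
have [R2 [R3 [BR2 BR3 ER]]] : exists R2 R3, [/\ alg2 iota x z R2, alg2 iota x z R3 &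
    \sum_(t | t != t0) iota (cf t) * e t = x ^+ L * (z ^+ Q * (z * R2) + x * R3)].
  apply: (big_ind (fun y => exists R2 R3, [/\ alg2 iota x z R2, alg2 iota x z R3 &
    y = x ^+ L * (z ^+ Q * (z * R2) + x * R3)])).
  - by exists 0, 0; split; rewrite ?mulr0 ?addr0 ?mulr0 //; apply: alg2_0.
  - move=> y1 y2 [R2 [R3 [BR2 BR3 ->]]] [S2 [S3 [BS2 BS3 ->]]].
    by exists (R2 + S2), (R3 + S3); split; [exact: Alg2D | exact: Alg2D | ring].
  move=> t tt0; have [c_eq0|ct] := eqVneq (cf t) 0.
    exists 0, 0; split; try exact: alg2_0.
    by rewrite c_eq0 rmorph0 mul0r !(mulr0, addr0).
  have [kt [H2 [H3 [_ BH2 BH3 ->]]]] := (He t).2.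
  have wt := t0min t ct.
  have : (L <= la (row t))%N.
    have := deg_lt t; have := deg_lt t0; move: wt; rewrite /weight -/L; nia.
  rewrite leq_eqVlt => /orP[/eqP EL|Llt].
    have Er := la_inj _ _ EL.
    have dt : (deg t0 < deg t)%N.
      rewrite ltn_neqAle; apply/andP; split.
        by apply: contraNneq tt0 => Ed; apply/eqP/row_inj.
      by move: wt; rewrite /weight -/L EL leq_add2l.
    exists (iota (cf t) * z ^+ (deg t - (deg t0).+1) * (iota kt + z * H2)),
      (iota (cf t) * H3); split.
    - by repeat (apply: Alg2D || apply: Alg2M || apply: Bz ||
               apply: Alg2X || apply: Alg2T || apply: Alg2C || by []).
    - by apply: Alg2M => //; apply: Alg2C.
    rewrite -EL -Er.
    have -> : (q (row t0) + deg t = Q + (deg t - (deg t0).+1).+1)%N by rewrite /Q; lia.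
    by rewrite exprD exprS; ring.
  have [w Ew] : exists w, (la (row t) = L + w.+1)%N.
    by exists (la (row t) - L.+1)%N; lia.
  exists 0, (iota (cf t) * x ^+ w *
    (z ^+ (q (row t) + deg t) * (iota kt + z * H2) + x * H3)); split.
  - exact: alg2_0.
  - by repeat (apply: Alg2D || apply: Alg2M || apply: Bz || apply: alg2X ||
               apply: Alg2X || apply: Alg2T || apply: Alg2C || by []).
  by rewrite Ew exprD exprS; ring.
rewrite (bigD1 t0) //= ER E0.
have [p [S [BS ES]]] := alg2_split (Alg2D (Alg2M (Alg2C iota x z (cf t0)) B2) BR2).
pose p0 := 'X^Q * ((cf t0 * kap)%:P + 'X * p).
have p00 : p0 != 0.
  rewrite mulf_neq0 -?size_poly_eq0 ?size_polyXn // size_poly_eq0.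
  apply: contraTneq (mulf_neq0 c0 kap0) => /(congr1 (horner^~ 0)).
  by rewrite hornerD hornerC hornerM hornerX mul0r addr0 horner0 => ->; rewrite eqxx.
have BS' : alg2 iota x z (z ^+ Q * z * S + iota (cf t0) * G3 + R3).
  by repeat (apply: Alg2D || apply: Alg2M || apply: Bz || apply: alg2X ||
               apply: Alg2X || apply: Alg2T || apply: Alg2C || by []).
have x1 : 0 < nu x by rewrite nux.
have [s0 ns] := nu_leading nuM nuD nuC x0 x1 nuz L p00 BS'.
have -> : iota (cf t0) * (x ^+ la (row t0) *
     (z ^+ (q (row t0) + deg t0) * (iota kap + z * G2) + x * G3)) +
  x ^+ L * (z ^+ Q * (z * R2) + x * R3) =
  x ^+ L * (ev1 iota z p0 + x * (z ^+ Q * z * S + iota (cf t0) * G3 + R3)).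
  rewrite -/L -/Q /p0 rmorphM rmorphXn rmorphD rmorphM /= ev1X ev1C rmorphM /=.
  transitivity (x ^+ L * (z ^+ Q * (iota (cf t0) * iota kap +
    z * (iota (cf t0) * G2 + R2)) + x * (iota (cf t0) * G3 + R3))); first by ring.
  by rewrite ES; ring.
case=> [/eqP|]; first by rewrite (negbTE s0).
rewrite ns nux mulr1 lez_nat leqNgt => /negP; apply.
rewrite /L /la /row /=.
have := ltn_ord (tag t0.1); have := ltn_ord t0.2; nia.
Qed.
End Independence.
End Counting.

(** * Values of polynomials of bounded degree *)

Section Bound.
Variables (k K : fieldType) (iota : {rmorphism k -> K}) (nu : K -> int).
Hypothesis nuM : forall x y, x != 0 -> y != 0 -> nu (x * y) = nu x + nu y.
Hypothesis nuD : forall x y, x != 0 -> y != 0 -> x + y != 0 ->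
  Num.min (nu x) (nu y) <= nu (x + y).
Hypothesis nuC : forall c, c != 0 -> nu (iota c) = 0.
Variables u v x z : K.
Local Notation P := (alg2 iota u v).
Local Notation vge := (vge nu).
Hypotheses (x0 : x != 0) (nux : nu x = 1).
Hypothesis nuz : forall p, p != 0 -> ev1 iota z p != 0 /\ nu (ev1 iota z p) = 0.
Variables (N b : nat).
Hypotheses (N0 : (0 < N)%N) (genN : generic_forms iota u v x z N).
Hypotheses (vu : vge 0 u) (v0 : v != 0) (nuv : nu v = b%:Z).

(** Let m = n F b.  By [independence] at least m^2 / (2 N) elements of k[u,v] are
    independent modulo the elements of value at least m, and by [spanning] at most
    D m^2 / (2 F b) are, up to lower order terms. *)
Lemma coprime_value_bound f f1 pf F :
  f = ev1 iota u pf + v * f1 -> P f1 -> pf != 0 -> vge F%:Z f ->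
  (F * b <= (size pf).-1 * N)%N.
Proof.
move=> Ef Pf1 pf0 vf; set D := (size pf).-1; set E := (F * b)%N.
rewrite leqNgt; apply/negP => DNE.
have : (0 < E)%N by lia.
rewrite muln_gt0 => /andP[F0 b0].
have vv : vge b%:Z v by right; rewrite nuv.
have [c indep] := independence nuM nuD nuC x0 nux nuz genN.
(* The value c + N n' of independence is at most that, n F b, of spanning, and y is
   large enough for the quadratic terms to dominate. *)
pose y := (D + 2 * c + 1)%N; pose n' := (y * E - c)%N.
have En' : (n' + c = y * E)%N by rewrite /n' subnK // /y; nia.
have [e [Pe indep_e]] := indep n'.
pose n := (N * y)%N.
have Hspan t := spanning nuM nuD nuC Ef Pf1 pf0 F0 b0 vu vv vf n (Pe t).
have [A HA] := fin_all_exists Hspan.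
have [|cf [cf0 cfA]] := linear_dependence A.
  rewrite !card_prod !card_ord -/D -(ltn_pmul2l (isT : 0 < 2)%N) !mulnA.
  rewrite !card_triangle /n.
  have n'c : (c < n')%N by rewrite /n' ltn_subRL /y; nia.
  have h1 : ((n' + c) * (N * y + 1) * D < n' * n'.+1)%N.
    have h2 : (y * (N * D) + y <= n' + c)%N by rewrite En'; nia.
    have h3 : ((N * y + 1) * D <= n' - c.+1)%N by rewrite /y in h2 *; lia.
    rewrite -mulnA; apply: leq_ltn_trans (leq_mul (leqnn _) h3) _.
    have [w Ew] : exists w, n' = (w + c.+1)%N by exists (n' - c.+1)%N; lia.
    by rewrite Ew addnK; clear; nia.
  rewrite -(ltn_pmul2l N0) in h1.
  rewrite [ltnRHS]mulnC; apply: leq_ltn_trans h1.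
  by rewrite En' /E; apply/eq_leq; ring.
apply: (indep_e cf cf0).
apply: (@vge_le _ _ _ (n * F * b)%:Z).
  rewrite lez_nat /n -mulnA -/E -mulnA -En' mulnDr; nia.
have -> : \sum_t iota (cf t) * e t = \sum_t iota (cf t) *
     (e t - \sum_s iota (A t s) * span_gen u v f s).
  have A0 : \sum_t iota (cf t) * (\sum_s iota (A t s) * span_gen u v f s) = 0.
    under eq_bigr do rewrite mulr_sumr.
    rewrite exchange_big big1 // => s _ /=.
    under eq_bigr do rewrite mulrA -rmorphM.
    by rewrite -mulr_suml -rmorph_sum cfA rmorph0 mul0r.
  rewrite -[LHS]subr0 -[X in _ - X]A0.
  by rewrite -sumrB; apply: eq_bigr => t _; rewrite mulrBr.
apply: vge_sum => // t _; rewrite -[_%:Z]add0r.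
by apply: (vgeM nuM) (HA t); exact: (vgeC nuC).
Qed.

(** A factor v has degree 1 and value b; without it, [coprime_value_bound] applies
    to f, whose restriction to v = 0 has degree at most d. *)
Lemma degree_value_bound (f : {poly {poly k}}) d F : f != 0 ->
  (forall j, (size (f`_j)%R <= d.+1 - j)%N) -> (N <= b ^ 2)%N ->
  vge F%:Z (ev2 iota v u f) -> (F <= d * b)%N.
Proof.
move=> f0 szf Nb vf.
have [|e fe emin] := @ex_minnP (fun e => f`_e != 0).
  by exists (size f).-1; rewrite -lead_coefE lead_coef_eq0.
have [|y Py Ey] := @ev2_split _ _ iota v u f e.
  by move=> i ie; apply/eqP; apply: contraLR ie => /emin; rewrite -leqNgt.
have := szf e; have : (0 < size (f`_e)%R)%N by rewrite size_poly_gt0.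
move=> sz0 sze.
have [Fe|eF] := leqP F (e * b); first apply: leq_trans Fe _.
  by rewrite leq_mul2r; apply/orP; right; clear -sz0 sze; lia.
have b0 : (0 < b)%N.
  by rewrite lt0n; apply: contraTneq Nb => ->; rewrite -ltnNge.
suff /coprime_value_bound : vge (F - e * b)%N (ev1 iota u f`_e + v * y).
  move=> /(_ _ _ erefl (alg2_sym Py) fe) bound.
  have : ((F - e * b) * b <= ((size (f`_e)%R).-1 * b) * b)%N.
    by apply: leq_trans bound _; rewrite -mulnA leq_mul2l mulnn Nb orbT.
  rewrite leq_pmul2r // => bound'.
  have ed : (e <= d)%N by clear -sz0 sze; lia.
  have szd : ((size (f`_e)%R).-1 <= d - e)%N by clear -sz0 sze; lia.
  have := leq_trans bound' (leq_mul szd (leqnn b)).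
  by rewrite mulnBl leq_subLR subnKC // leq_mul2r ed orbT.
set f' := (X in vge _ X) in Ey *.
have [->|f'0] := eqVneq f' 0; first by left.
move: vf; rewrite Ey => -[/eqP|].
  by rewrite mulf_eq0 (negbTE f'0) orbF expf_eq0 (negbTE v0) andbF.
rewrite nuM ?expf_neq0 // (nuX nuM nuC) // nuv => ?; right.
by rewrite -subzn 1?ltnW // PoszM lerBlDl.
Qed.

End Bound.

(** * Initial forms for a Hamburger-Noether expansion *)

(** The rows of an expansion, with coefficients in any ring: the sum over j has
    at most one term. *)
Definition row_tail (S : hn_structure) (T : comNzRingType) (a : 'I_(hn_b S) -> T)
    (i : nat) (X : T) : T :=
  \sum_(j < (hn_g' S).+1 | hn_s S j == i)
    \sum_(l < @hn_len S j) a (tagnat.Rank j l) * X ^+ (hn_k S j + l).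

Section Constants.
Variable k : closedFieldType.

Fact cstK_is_zmod_morphism : zmod_morphism (@cstK k).
Proof. by move=> c d; rewrite /cstK /toK mpolyCB rmorphB. Qed.
Fact cstK_is_monoid_morphism : monoid_morphism (@cstK k).
Proof.
split=> [|c d]; first by rewrite /cstK /toK mpolyC1 rmorph1.
by rewrite /cstK /toK mpolyCM rmorphM.
Qed.
HB.instance Definition _ :=
  GRing.isZmodMorphism.Build k (ratUV k) (@cstK k) cstK_is_zmod_morphism.
HB.instance Definition _ :=
  GRing.isMonoidMorphism.Build k (ratUV k) (@cstK k) cstK_is_monoid_morphism.

End Constants.

Section Fraction.
Import generic_quotient.
Local Open Scope quotient_scope.

Lemma fraction_numden (R : idomainType) (z : {fraction R}) :
  exists n d, d != 0 /\ z * FracField.tofrac d = FracField.tofrac n.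
Proof.
elim/quotW: z => r; exists \n_r, \d_r; split; first exact: denom_ratioP.
unlock FracField.tofrac; rewrite -[LHS]FracField.pi_mul /FracField.mulf.
rewrite !numden_Ratio ?oner_eq0 // mulr1.
apply/eqmodP; rewrite /= FracField.equivfE !numden_Ratio ?denom_ratioP ?oner_eq0 //.
by rewrite mulr1 mulrC.
Qed.

End Fraction.

Lemma toK_sum (k : closedFieldType) (f : polyUV k) d : (msize f <= d)%N ->
  toK f = \sum_(m : 'X_{1..2 < d})
            cstK f@_m * (uK ^+ (m ord0) * vK ^+ (m ord_max)).
Proof.
move=> fd; rewrite {1}(mpolywE fd) /toK rmorph_sum; apply: eq_bigr => m _.
rewrite -mul_mpolyC rmorphM mpolyXE_id rmorph_prod !big_ord_recl big_ord0 mulr1.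
by rewrite !rmorphXn /=; have -> : lift ord0 ord0 = ord_max :> 'I_2 by apply: val_inj.
Qed.

Section DivisorialValuation.
Variables (k : closedFieldType) (nu : ratUV k -> int).
Hypothesis nu_div : divisorial nu.
Local Notation K := (ratUV k).
Local Notation iota := (@cstK k).

Lemma divisorialM x y : x != 0 -> y != 0 -> nu (x * y) = nu x + nu y.
Proof. by case: nu_div => -[+ _ _ _ _]; apply. Qed.

Lemma divisorialD x y : x != 0 -> y != 0 -> x + y != 0 ->
  Num.min (nu x) (nu y) <= nu (x + y).
Proof. by case: nu_div => -[_ + _ _ _]; apply. Qed.

Lemma divisorialC c : c != 0 -> nu (iota c) = 0.
Proof.
have ge0 d : d != 0 -> 0 <= nu (iota d).
  move=> d0; case: nu_div => _ _ cen _.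
  have /cen[//|//] : iota d != 0 by rewrite fmorph_eq0.
  exists d%:MP, 1; rewrite mcoeff1 eqxx oner_eq0; split=> //.
  by rewrite /evalK2 /evalK !mmapC /= rmorph1 mulr1.
have n1 : nu 1 = 0.
  have := divisorialM (oner_neq0 K) (oner_neq0 K); rewrite mulr1 => E.
  by apply: (addrI (nu 1)); rewrite -E addr0.
move=> c0; have c1 := ge0 c c0.
have c2 : 0 <= nu (iota c^-1) by apply: ge0; rewrite invr_eq0.
have := divisorialM (x := iota c) (y := iota c^-1).
rewrite !fmorph_eq0 invr_eq0 => /(_ c0 c0).
rewrite -rmorphM divff // rmorph1 n1; lia.
Qed.

End DivisorialValuation.

Section Expansion.
Variables (k : closedFieldType) (S : hn_structure) (nu : ratUV k -> int).
Variables (a : 'I_(hn_b S) -> k) (w : nat -> ratUV k).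
Hypotheses (nu_div : divisorial nu) (hS : hn_expansion nu a w).
Local Notation K := (ratUV k).
Local Notation iota := (@cstK k).
Local Notation alg2 := (alg2 iota).
Local Notation g := (hn_g S).
Local Notation s := (hn_s S).
Local Notation h := (hn_h S).
Local Notation kk := (hn_k S).
Local Notation xg := (w (s g).+1).
Local Notation zg := (w (s g).+2).
Local Notation vge := (vge nu).

Let nuM := divisorialM nu_div.
Let nuD := divisorialD nu_div.
Let nuC := divisorialC nu_div.

Lemma hn_s_lt j j' : (j < j')%N -> (j' <= g)%N -> (s j < s j')%N.
Proof.
case: hS => -[[_ smono _ _ _] _] _ _ _ _.
elim: j' => // j' IH; rewrite ltnS leq_eqVlt => /orP[/eqP->|jj'] j'g.
  exact: smono.
by apply: ltn_trans (smono _ j'g); apply: IH => //; exact: ltnW.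
Qed.

Lemma hn_s_le j : (j <= g)%N -> (s j <= s g)%N.
Proof.
rewrite leq_eqVlt => /orP[/eqP->//|jg]; exact/ltnW/hn_s_lt.
Qed.

Lemma hn_g'_le : (hn_g' S <= g)%N.
Proof. by rewrite /hn_g'; case: ifP => // _; exact: leq_pred. Qed.

Lemma w_neq0 i : (i <= s g)%N -> w i.+1 != 0.
Proof. by case: hS => _ _ _ [+ _] _ => /[apply] -[]. Qed.

Lemma w_gt0 i : (i <= s g)%N -> 0 < nu (w i.+1).
Proof. by case: hS => _ _ _ [+ _] _ => /[apply] -[]. Qed.

Lemma zg_neq0 : zg != 0.
Proof. by case: hS => _ _ _ [_ /(_ _ (leqnn _))[]]. Qed.

Lemma nu_zg : nu zg = 0. Proof. by case: hS => _ _ _ _ []. Qed.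

Lemma zg_transcendental p : p != 0 ->
  ev1 iota zg p != 0 /\ nu (ev1 iota zg p) = 0.
Proof.
by move: p; apply: (residually_transcendental nuM nuC); case: hS => _ _ _ _ [].
Qed.

Lemma w2_neq0 i : (i <= s g)%N -> w i.+2 != 0.
Proof.
by rewrite leq_eqVlt => /orP[/eqP->|/w_neq0//]; exact: zg_neq0.
Qed.

Lemma w2_ge0 i : (i <= s g)%N -> 0 <= nu (w i.+2).
Proof.
by rewrite leq_eqVlt => /orP[/eqP->|/w_gt0/ltW//]; rewrite nu_zg.
Qed.

Lemma w_monomial i : (0 < i < s g)%N -> (forall j, (j <= g)%N -> i <> s j) ->
  w i = w i.+1 ^+ h i * w i.+2.
Proof. by case: hS => _ _ [_ _ +] _ _; apply. Qed.

(** The rows between two distinguished ones compose to a monomial transformation of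
    determinant 1 or - 1. *)
Lemma monomial_block j : (j < g)%N ->
  exists A B C D, [/\ w (s j).+1 = w (s j.+1).+1 ^+ A * w (s j.+1) ^+ B,
    w (s j).+2 = w (s j.+1).+1 ^+ C * w (s j.+1) ^+ D &
    (A * D = C * B + 1 \/ C * B = A * D + 1)%N].
Proof.
move=> jg; have sj := hn_s_lt (ltnSn j) jg.
suff main l : (s j + l.+1 <= s j.+1)%N -> exists A B C D,
   [/\ w (s j).+1 = w (s j + l.+1).+1 ^+ A * w (s j + l.+1)%N ^+ B,
    w (s j).+2 = w (s j + l.+1).+1 ^+ C * w (s j + l.+1)%N ^+ D &
    (A * D = C * B + 1 \/ C * B = A * D + 1)%N].
  have := main (s j.+1 - (s j).+1)%N; rewrite -addSnnS subnKC //; exact.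
elim: l => [|l IHl] lL.
  by exists 0%N, 1%N, 1%N, 0%N; rewrite addn1 !expr0 !expr1 mul1r mulr1; split=> //; right.
have [|A [B [C [D [Ex Ez det]]]]] := IHl; first by lia.
set p := (s j + l.+1)%N in Ex Ez.
have psj : (p < s j.+1)%N by rewrite /p; lia.
have wp : w p = w p.+1 ^+ h p * w p.+2.
  have sg := hn_s_le jg.
  apply: w_monomial; first by rewrite (leq_trans psj sg) andbT /p; lia.
  move=> i ig Ep; case: (ltngtP i j.+1) => [ij|ij|Ei].
  - have : (s i <= s j)%N.
      move: ij; rewrite ltnS leq_eqVlt => /orP[/eqP->//|ij].
      by apply/ltnW/hn_s_lt => //; exact: ltnW.
    by rewrite -Ep /p; lia.
  - by have := hn_s_lt ij ig; lia.
  - by rewrite -Ei in psj; lia.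
have Ep2 : (s j + l.+2 = p.+1)%N by rewrite /p; lia.
rewrite Ep2; exists B, (A + h p * B)%N, D, (C + h p * D)%N; split.
- by rewrite Ex wp exprMn -exprM exprD; ring.
- by rewrite Ez wp exprMn -exprM exprD; ring.
- by case: det => det; [right|left]; nia.
Qed.

Section Row.
Variables (j : nat) (jg : (j <= hn_g' S)%N).
Local Notation jo := (Ordinal (jg : (j < (hn_g' S).+1)%N)).
Local Notation x := (w (s j).+1).
Local Notation z := (w (s j).+2).

Lemma free_row : exists T,
  [/\ forall y, alg2 x y T &
      w (s j) = x ^+ kk j *
        (iota (@hn_coef k S a jo ord0) + x ^+ (h (s j) - kk j) * z + x * T)].
Proof.
case: hS => -[[_ _ _ kh _] _] _ [/(_ jo) /= Ew _ _] _ _.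
exists (\sum_(i < h (s j) - kk j)
   iota (hn_coef a (lift ord0 i : 'I_(@hn_len S jo))) * x ^+ i).
split=> [y|].
  by apply: alg2_sum => i _; apply: Alg2M; [apply: Alg2C | apply/alg2X/Alg2X].
rewrite Ew big_ord_recl /= addn0.
have -> : x ^+ h (s j) = x ^+ kk j * x ^+ (h (s j) - kk j).
  by rewrite -exprD subnKC // kh // (leq_trans jg) // hn_g'_le.
rewrite [RHS]mulrDr mulr_sumr mulr_sumr.
set U := \sum_(i < _) _; set V := \sum_(i < _) _.
have -> : U = V.
  apply: eq_bigr => i _; rewrite /bump /= exprD exprS; ring.
ring.
Qed.

(** For a free last row with h = k, the residue of t is that of c + z, which is not 0
    because z is residually transcendental. *)
Lemma free_row_unit : (0 < j)%N -> exists t T,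
  [/\ w (s j) = x ^+ kk j * t, t != 0, nu t = 0, forall y, alg2 x y T &
   exists2 c, c != 0 & t = iota c + x ^+ (h (s j) - kk j) * z + x * T].
Proof.
move=> j0; have [T [BT Ew]] := free_row.
have jg' := leq_trans jg hn_g'_le; have sj := hn_s_le jg'.
set c := hn_coef _ _ in Ew; set r := (_ - _)%N in Ew *.
have c0 : c != 0.
  by case: hS => -[_ hU] _ _ _ _; exact: (hU jo j0).
exists (iota c + x ^+ r * z + x * T), T.
have x0 := w_neq0 sj; have x1 := w_gt0 sj.
have vx : vge 1 x by right.
have vT : vge 0 T.
  apply: (vge_alg2 nuM nuD nuC _ _ (BT x)); right; exact: ltW.
have vxT : vge 1 (x * T) by rewrite -[1]addr0; exact: (vgeM nuM).
have vz : vge 0 z by right; exact: w2_ge0.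
suff [t0 nt] : iota c + x ^+ r * z + x * T != 0 /\
    nu (iota c + x ^+ r * z + x * T) = 0 by split=> //; exists c.
have ic0 : iota c != 0 by rewrite fmorph_eq0.
have [vrz|] : vge 1 (x ^+ r * z) \/ (r = 0%N /\ j = g).
  case: (posnP r) => [r0|r0]; last first.
    left; have := vgeM nuM (vgeX nuM nuC r vx) vz.
    by apply: vge_le; lia.
  rewrite r0 expr0 mul1r.
  move: jg'; rewrite leq_eqVlt => /orP[/eqP ->|jlt]; first by right.
  left; right; exact: (w_gt0 (hn_s_lt jlt (leqnn g))).
- rewrite -addrA -(nuC c0); apply: (nu_add_gt nuM nuD nuC ic0).
  by rewrite nuC // add0r; apply: (vgeD nuD).
case=> -> Ej; rewrite expr0 mul1r.
have [s0 ns] : iota c + z != 0 /\ nu (iota c + z) = 0.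
  case: hS => _ _ _ _ [_ /(_ (- c))]; rewrite -Ej rmorphN opprK addrC.
  by [].
rewrite -[X in _ = X]ns; apply: (nu_add_gt nuM nuD nuC s0).
by rewrite ns add0r.
Qed.

End Row.

Variables (vs : K).
Hypothesis v'_in : alg2 uK vs (uK ^+ h 0%N * w 2%N).
Local Notation e := (hn_e S nu w).
Local Notation beta := (max_contact S nu w).

(** The slope M is n (N n + n'), where n and n' are the values of w_{s_j} and
    w_{s_j+1} divided by e_{j+1}. *)
Lemma step_forms j N t : (j < g)%N -> t != 0 -> nu t = 0 ->
  w (s j.+1) = w (s j.+1).+1 ^+ kk j.+1 * t ->
  monomial_forms iota uK vs (w (s j).+1) (w (s j).+2) N ->
  beta j.+1 = N%:Z * e j + nu (w (s j).+2) ->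
  exists M, [/\ (0 < M)%N, poly_forms iota uK vs (w (s j.+1).+1) t M &
    hn_n S nu w j.+1 * beta j.+1 = M%:Z * e j.+1].
Proof.
move=> jg t0 nt Ey mon Eb.
have [A [B [C [D [Ex Ez det]]]]] := monomial_block jg.
have sj1 := hn_s_le jg; have sj := hn_s_lt (ltnSn j) jg.
set x := w (s j.+1).+1 in Ex Ez Ey *; set kj := kk j.+1 in Ey.
have x0 : x != 0 := w_neq0 sj1; have x1 : 0 < nu x := w_gt0 sj1.
pose n := (A + kj * B)%N; pose n' := (C + kj * D)%N.
have Ex' : w (s j).+1 = x ^+ n * t ^+ B.
  by rewrite Ex Ey exprMn -exprM mulrA -exprD.
have Ez' : w (s j).+2 = x ^+ n' * t ^+ D.
  by rewrite Ez Ey exprMn -exprM mulrA -exprD.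
have nu_mon m q : nu (x ^+ m * t ^+ q) = m%:Z * nu x.
  exact (nu_monomial nuM nuC m q x0 t0 nt).
have En : e j = n%:Z * e j.+1 by rewrite /hn_e Ex' nu_mon.
have En' : nu (w (s j).+2) = n'%:Z * e j.+1 by rewrite Ez' nu_mon.
have slt : (s j < s g)%N := leq_trans sj sj1.
have n0 : (0 < n)%N.
  by have := w_gt0 (ltnW slt); rewrite Ex' nu_mon; case: (n) => //; rewrite mul0r.
have n'0 : (0 < n')%N.
  by have := w_gt0 slt; rewrite Ez' nu_mon; case: (n') => //; rewrite mul0r.
exists (n * (N * n + n'))%N; split.
- by rewrite muln_gt0 n0 addn_gt0 n'0 orbT.
- apply: (poly_forms_monomial Ex' Ez' n0 n'0 _ mon).
  by rewrite /n /n'; case: det => ?; [left|right]; nia.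
have -> : hn_n S nu w j.+1 = n by rewrite /hn_n En mulzK // gt_eqF.
rewrite Eb En En' !PoszM PoszD PoszM; ring.
Qed.

(** The slopes N_j obey the same recursion as the maximal contact values. *)
Lemma monomial_forms_row j : (j <= hn_g' S)%N -> exists N, [/\ (0 < N)%N,
  monomial_forms iota uK vs (w (s j).+1) (w (s j).+2) N &
  beta j.+1 = N%:Z * e j + nu (w (s j).+2)].
Proof.
case: (hS) => -[[s0 _ k0 kh _] _] [_ w1] _ _ _.
elim: j => [_|j IHj jg].
  have h0 : (0 < h 0)%N by rewrite -{1}k0 -{2}s0 kh.
  exists (h 0%N); split=> //; last first.
    rewrite /= s0 k0 /hn_n mul1r /hn_e s0.
    have -> : (h 0%N)%:Z = 1 + (h 0 - 1)%N%:Z by lia.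
    by rewrite mulrDl mul1r.
  exists 0%N => al be I alL; exists 1, 0, 0, 0.
  split; rewrite ?oner_eq0 //; try exact: alg2_0.
  rewrite s0 w1 rmorph1 !mulr0 !addr0 mulr1.
  have -> : al = (al - h 0 * be + h 0 * be)%N by lia.
  rewrite exprD -mulrA exprM -exprMn.
  by apply: Alg2M; apply: alg2X => //; exact: Alg2X.
have [|N [N0 mon Eb]] := IHj; first exact: ltnW.
have jg' : (j < g)%N := leq_trans jg hn_g'_le.
have [t [T [Et t0 nt BT [c c0 Ec]]]] := free_row_unit jg isT.
have [M [M0 pf EM]] := step_forms jg' t0 nt Et mon Eb.
exists (M + (h (s j.+1) - kk j.+1))%N; split; first by rewrite addn_gt0 M0.
  exact: (monomial_forms_free c0 (BT _) (BT _) Ec pf).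
by rewrite [LHS]/= -/(hn_n S nu w j.+1) -/(beta j.+1) EM PoszD; ring.
Qed.

Lemma w_row i : (i <= s g)%N ->
  w i = row_tail (iota \o a) i (w i.+1) + w i.+1 ^+ h i * w i.+2.
Proof.
move=> isg; case: (hS) => -[[s0 _ _ _ lf] _] _ [Ew Elast _] _ _.
case: (pickP (fun j : 'I_(hn_g' S).+1 => s j == i)) => [j /eqP Ej|noj].
  have jg := leq_trans (leq_ord j) hn_g'_le.
  rewrite /row_tail (big_pred1 j) => [|j' /=].
    by rewrite -Ej (Ew j).
  have j'g := leq_trans (leq_ord j') hn_g'_le.
  rewrite -Ej -val_eqE /=; apply/eqP/eqP => [|->//] Es.
  case: (ltngtP j' j) => // jj'.
    by have := hn_s_lt jj' jg; lia.
  by have := hn_s_lt jj' j'g; lia.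
rewrite /row_tail big_pred0 // add0r.
have nfree : ~~ hn_lastfree S -> g = (hn_g' S).+1.
  rewrite /hn_g' => /negbTE fr; rewrite fr.
  by case: lf => [|[/prednK]]; rewrite ?fr.
have inoj j : (j <= hn_g' S)%N -> s j <> i.
  by move=> jg'; have := noj (Ordinal (jg' : (j < _.+1)%N)) => /= /eqP.
have [free|/nfree Eg] := boolP (hn_lastfree S).
  have Eg : hn_g' S = g by rewrite /hn_g' free.
  apply: w_monomial; last by move=> j jg E; apply: (inoj j); rewrite ?Eg.
  have := inoj 0%N isT; have := inoj g; rewrite Eg s0 => /(_ (leqnn g)).
  by move: isg; rewrite leq_eqVlt lt0n => /orP[/eqP->//|->] _ /eqP; rewrite eq_sym => ->.
move: isg; rewrite leq_eqVlt => /orP[/eqP->|isg].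
  by apply: Elast; apply/negP => fr; move: Eg; rewrite /hn_g' fr; lia.
apply: w_monomial.
  have := inoj 0%N isT; rewrite s0 isg andbT lt0n => /eqP.
  by rewrite eq_sym.
move=> j; rewrite {1}Eg leq_eqVlt => /orP[/eqP Ej|].
  by rewrite Ej -Eg => Ei; rewrite Ei ltnn in isg.
by rewrite ltnS => /inoj H E; apply: H.
Qed.

Lemma w_alg2 i : (i <= (s g).+2)%N -> alg2 xg zg (w i).
Proof.
suff main : forall l, (l <= (s g).+1)%N ->
    alg2 xg zg (w ((s g).+1 - l)%N) /\ alg2 xg zg (w ((s g).+2 - l)%N).
  rewrite leq_eqVlt => /orP[/eqP->|iL]; first exact: Alg2T.
  by have [] := main ((s g).+1 - i)%N (leq_subr _ _); rewrite subKn.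
elim=> {i} [_|l IHl lL]; first by rewrite !subn0; split; [apply: Alg2X|apply: Alg2T].
have [B1 B2] := IHl (ltnW lL); have E : ((s g).+2 - l.+1 = (s g).+1 - l)%N by [].
rewrite E; split=> //.
move: B1 B2; have [i [Ei1 Ei2 Ei3 isg]] : exists i, [/\ ((s g).+1 - l.+1 = i)%N,
    ((s g).+1 - l = i.+1)%N, ((s g).+2 - l = i.+2)%N & (i <= s g)%N].
  by exists (s g - l)%N; split; lia.
rewrite Ei1 Ei2 Ei3 => B1 B2; rewrite (w_row isg).
apply: Alg2D; last by apply: Alg2M => //; apply: alg2X.
apply: alg2_sum => j _; apply: alg2_sum => c _.
by apply: Alg2M; [apply: Alg2C|apply: alg2X].
Qed.

(** All values on k[x,z], hence on K, are multiples of nu(x), and nu takes the value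
    1. *)
Lemma nu_xg : nu xg = 1.
Proof.
have x1 := w_gt0 (leqnn (s g)).
case: (nu_div) => _ [z z0 nz1] _ _.
have [p [q [q0 Ez0]]] := fraction_numden z.
have Ez : z * toK q = toK p := Ez0.
have in_alg2 f : alg2 xg zg (toK f).
  rewrite (toK_sum (leqnn _)); apply: alg2_sum => m _.
  case: (hS) => _ [<- <-] _ _ _.
  by apply: Alg2M; [exact: Alg2C | apply: Alg2M; apply: alg2X; exact: w_alg2].
have tq0 : toK q != 0 by rewrite tofrac_eq0.
have En : 1 + nu (toK q) = nu (toK p) by rewrite -Ez (nuM z0 tq0) nz1.
have dvd f : toK f != 0 -> (nu xg %| nu (toK f))%Z.
  by apply: (nu_generic_dvd nuM nuD nuC (w_neq0 (leqnn _)) x1 zg_transcendental (in_alg2 f)).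
have /dvdzP[c1 E1] := dvd q tq0.
have /dvdzP[c2 E2] : (nu xg %| nu (toK p))%Z.
  by apply: dvd; rewrite -Ez (mulf_neq0 z0 tq0).
have : (nu xg %| 1)%Z.
  by apply/dvdzP; exists (c2 - c1); rewrite mulrBl -E1 -E2 -En addrK.
by rewrite dvdz1 => /eqP E; rewrite -(gez0_abs (ltW x1)) E.
Qed.

Lemma generic_forms_expansion : exists N, [/\ (0 < N)%N,
  generic_forms iota uK vs xg zg N & beta g.+1 = N].
Proof.
have Ee : e g = 1 by exact: nu_xg.
case: (hS) => -[[_ _ _ _ lf] _] _ [_ Elast _] _ _.
have [free|fr] := boolP (hn_lastfree S).
  have Eg : hn_g' S = g by rewrite /hn_g' free.
  have [|N [N0 mon Eb]] := @monomial_forms_row g; first by rewrite Eg.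
  exists N; split=> //; first exact: generic_forms_free.
  by rewrite Eb Ee nu_zg; lia.
have [g0 Ek] : (0 < g)%N /\ kk g = h (s g) by case: lf => // free; rewrite free in fr.
have Eg : g = (hn_g' S).+1 by rewrite /hn_g' (negbTE fr) prednK.
have [N [N0 mon Eb]] := monomial_forms_row (leqnn (hn_g' S)).
have jg : (hn_g' S < g)%N by rewrite Eg.
have Ew : w (s (hn_g' S).+1) = w (s (hn_g' S).+1).+1 ^+ kk (hn_g' S).+1 * zg.
  by rewrite -Eg Ek; apply: Elast.
have [M [M0 pf EM]] := step_forms jg zg_neq0 nu_zg Ew mon Eb.
rewrite -Eg in pf EM; exists M; split=> //; first exact: generic_forms_satellite.
have -> : beta g.+1 = hn_n S nu w g * beta g + (h (s g) - kk g)%N%:Z * e g + nu zg by [].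
by rewrite nu_zg Ek subnn mul0r !addr0 EM Ee mulr1.
Qed.

End Expansion.

(** * The generic expansion and openness *)

Section Semicontinuity.
Variables (k : fieldType) (n : nat).

(** A maximal minor that does not vanish at a0 is the polynomial required. *)
Lemma independence_open (I J : finType) (E : I -> J -> {mpoly k[n]}) (a0 : 'I_n -> k) :
  (forall c : I -> k, (exists i, c i != 0) ->
     exists j, \sum_i c i * (E i j).@[a0] != 0) ->
  exists D : {mpoly k[n]}, D.@[a0] != 0 /\ forall a, D.@[a] != 0 ->
    forall c : I -> k, (exists i, c i != 0) ->
      exists j, \sum_i c i * (E i j).@[a] != 0.
Proof.
pose M : 'M[{mpoly k[n]}]_(#|I|, #|J|) := \matrix_(i, j) E (enum_val i) (enum_val j).
pose Ma a := map_mx (meval a) M.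
have MaE a (v : 'rV_#|I|) j : (v *m Ma a) 0 j =
    \sum_i v 0 (enum_rank i) * (E i (enum_val j)).@[a].
  rewrite mxE (reindex (@enum_rank I)) /=; last exact/onW_bij/enum_rank_bij.
  by apply: eq_bigr => i _; rewrite !mxE enum_rankK.
move=> ind0.
have free0 : row_free (Ma a0).
  apply: inj_row_free => v vM; apply/rowP => i; rewrite mxE.
  apply/eqP; apply: contraT => vi.
  case: (ind0 (fun i => v 0 (enum_rank i))); first by exists (enum_val i); rewrite enum_valK.
  move=> j; have := MaE a0 v (enum_rank j); rewrite enum_rankK vM mxE => <-.
  by rewrite eqxx.
have full0 : row_full (Ma a0)^T by rewrite /row_full mxrank_tr.
have [f fP] : exists f : 'I_#|I| -> 'I_#|J|, rowsub f (Ma a0)^T \in unitmx.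
  by exists (fullrankfun full0); exact: fullrowsub_unit.
pose D := \det (rowsub f M^T).
have DE a : D.@[a] = \det (rowsub f (Ma a)^T).
  by rewrite -det_map_mx map_mxsub map_trmx.
exists D; split=> [|a]; rewrite DE.
  by rewrite -unitfE -unitmxE.
rewrite -unitfE -unitmxE => unitD c [i ci].
apply/existsP; apply: contraT; rewrite negb_exists => /forallP c0.
pose v : 'rV_#|I| := \row_i c (enum_val i).
have vM : v *m Ma a = 0.
  apply/rowP => j; rewrite MaE mxE.
  have := c0 (enum_val j); rewrite negbK => /eqP c0j; rewrite -[RHS]c0j.
  by apply: eq_bigr => i' _; rewrite mxE enum_rankK.
have : rowsub f (Ma a)^T *m v^T = 0.
  by rewrite mul_rowsub_mx -trmx_mul vM trmx0; apply/matrixP => ? ?; rewrite !mxE.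
move=> Ev; have := mulKmx unitD v^T; rewrite Ev mulmx0.
move=> /matrixP /(_ (enum_rank i) 0); rewrite !mxE enum_rankK => ci0.
by rewrite -ci0 eqxx in ci.
Qed.

End Semicontinuity.

Section GenericExpansion.
Variable S : hn_structure.
Local Notation s := (hn_s S).
Local Notation g := (hn_g S).
Local Notation h := (hn_h S).

(** The pair (w_{i-1}, w_i) for i = s_g + 1 - n, computed from the last pair. *)
Fixpoint hn_pair (T : comNzRingType) (a : 'I_(hn_b S) -> T) (x z : T) (n : nat) : T * T :=
  if n is n'.+1 then
    let p := hn_pair a x z n' in
    (row_tail a (s g - n')%N p.1 + p.1 ^+ h (s g - n')%N * p.2, p.1)
  else (x, z).

Lemma row_tail_morph (T T' : comNzRingType) (phi : {rmorphism T -> T'}) a i X :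
  phi (row_tail (S := S) a i X) = row_tail (phi \o a) i (phi X).
Proof.
rewrite /row_tail rmorph_sum; apply: eq_bigr => j _.
rewrite rmorph_sum; apply: eq_bigr => l _.
by rewrite rmorphM rmorphXn.
Qed.

Lemma hn_pair_morph (T T' : comNzRingType) (phi : {rmorphism T -> T'}) a x z n :
  hn_pair (phi \o a) (phi x) (phi z) n =
    (phi (hn_pair a x z n).1, phi (hn_pair a x z n).2).
Proof.
elim: n => //= n ->; congr (_, _) => /=.
by rewrite rmorphD rmorphM rmorphXn row_tail_morph.
Qed.

Lemma hn_pairE (T : comNzRingType) (a : 'I_(hn_b S) -> T) (w : nat -> T) n :
  (forall i, (i <= s g)%N ->
     w i = row_tail a i (w i.+1) + w i.+1 ^+ h i * w i.+2) ->
  (n <= (s g).+1)%N ->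
  hn_pair a (w (s g).+1) (w (s g).+2) n =
    (w ((s g).+1 - n)%N, w ((s g).+2 - n)%N).
Proof.
move=> row; elim: n => [|n IHn] nL; first by rewrite !subn0.
rewrite /= IHn 1?ltnW //=.
have [i [Ei isg]] : exists i, (s g - n = i /\ i <= s g)%N.
  by exists (s g - n)%N; split=> //; exact: leq_subr.
have -> : ((s g).+1 - n = i.+1)%N by lia.
have -> : ((s g).+2 - n = i.+2)%N by lia.
have -> : ((s g).+1 - n.+1 = i)%N by lia.
have -> : ((s g).+2 - n.+1 = i.+1)%N by lia.
by rewrite Ei -row.
Qed.

Variable k : closedFieldType.
Local Notation A := {mpoly k[hn_b S]}.
Local Notation K := (ratUV k).
Local Notation iota := (@cstK k).

(** The coefficients are the coordinates on U_Gamma, the outer variable is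
    w_{s_g} and the inner one w_{s_g+1}. *)
Definition generic_vu : {poly {poly A}} * {poly {poly A}} :=
  hn_pair (fun r : 'I_(hn_b S) => ('X_r)%:P%:P) 'X ('X%:P) (s g).+1.

Definition generic_mon (m : 'X_{1..2}) : {poly {poly A}} :=
  generic_vu.2 ^+ (m ord0) * generic_vu.1 ^+ (m ord_max).

Definition specialize (a : 'I_(hn_b S) -> k) : {poly {poly A}} -> {poly {poly k}} :=
  map_poly (map_poly (meval a)).
HB.instance Definition _ a := GRing.RMorphism.on (specialize a).

Lemma ev2_generic_mon (a : 'I_(hn_b S) -> k) (w : nat -> K) m :
  (forall i, (i <= s g)%N ->
     w i = row_tail (iota \o a) i (w i.+1) + w i.+1 ^+ h i * w i.+2) ->
  ev2 iota (w (s g).+1) (w (s g).+2) (specialize a (generic_mon m)) =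
    w 1%N ^+ (m ord0) * w 0%N ^+ (m ord_max).
Proof.
move=> row; have := hn_pairE row (leqnn _).
rewrite subnn subSn ?subnn // => Epair.
pose phi : {rmorphism {poly {poly A}} -> K} :=
  ev2 iota (w (s g).+1) (w (s g).+2) \o specialize a.
have phiX : phi 'X = w (s g).+1.
  by rewrite /phi /= /specialize map_polyX ev2X.
have phiZ : phi ('X%:P) = w (s g).+2.
  by rewrite /phi /= /specialize map_polyC /= map_polyX ev2C ev1X.
have := hn_pair_morph phi (fun r : 'I_(hn_b S) => ('X_r)%:P%:P) 'X 'X%:P (s g).+1.
rewrite phiX phiZ.
have -> : hn_pair (phi \o (fun r : 'I_(hn_b S) => ('X_r)%:P%:P))
   (w (s g).+1) (w (s g).+2) (s g).+1 =
   hn_pair (iota \o a) (w (s g).+1) (w (s g).+2) (s g).+1.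
  congr (hn_pair _ _ _ _); apply/boolp.funext => r.
  by rewrite /phi /= /specialize map_polyC /= map_polyC /= mevalXU ev2C ev1C.
rewrite Epair => -[Ev Eu].
by rewrite /generic_mon !rmorphM !rmorphXn /= Ev Eu.
Qed.

End GenericExpansion.

(** * Convergence of the normalised maximal values *)

Section Fekete.
Import numFieldNormedType.Exports.
Local Open Scope classical_set_scope.
Variable R : realType.

(** Fekete's lemma: the limit is the supremum. *)
Lemma superadditive_cvg (u : nat -> nat) (b : nat) :
  (forall d e, (u d + u e <= u (d + e))%N) -> (forall d, (u d <= d * b)%N) ->
  exists2 l : R, (fun d : nat => (u d)%:R / d%:R : R) @ \oo --> l & l <= b%:R.
Proof.
move=> usup ub.
pose A := [set x : R | exists2 d, (0 < d)%N & x = (u d)%:R / d%:R].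
have Ab : ubound A b%:R.
  move=> _ [d d0 ->]; rewrite ler_pdivrMr ?ltr0n // -natrM ler_nat mulnC.
  exact: ub.
have hA : has_sup A by split; [exists ((u 1)%:R / 1%:R); exists 1%N | exists b%:R].
exists (sup A); last by apply: ge_sup => //; case: hA.
have uM n d : (n * u d <= u (n * d))%N.
  elim: n => // n IHn; rewrite !mulSn.
  exact: leq_trans (leq_add (leqnn _) IHn) (usup _ _).
apply/cvgrPdist_le => eps eps0.
have eps20 : 0 < eps / 2 by rewrite divr_gt0.
have [_ [D D0 ->] Dl] := sup_adherent eps20 hA.
have D0' : (0 : R) < D%:R by rewrite ltr0n.
near=> n.
have n0 : (0 < n)%N by near: n; exact: nbhs_infty_gt.
have n0' : (0 : R) < n%:R by rewrite ltr0n.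
have nl : (u D)%:R / (eps / 2) <= n%:R :> R by near: n; exact: nbhs_infty_ger.
have ul : (u n)%:R / n%:R <= sup A by apply: ub_le_sup; [case: hA | exists n].
rewrite ger0_norm ?subr_ge0 //.
suff : (u D)%:R / D%:R - eps / 2 <= (u n)%:R / n%:R :> R by lra.
rewrite ler_pdivrMr // in nl.
rewrite ler_pdivlMr //.
have h1 : (u D)%:R * (n%:R - D%:R) <= (u n)%:R * D%:R :> R.
  have e1 : (u D * n <= u n * D + u D * D)%N.
    have := leq_trans (uM (n %/ D)%N D) (_ : _ <= u n)%N.
    have := usup (n %/ D * D)%N (n %% D)%N; rewrite -divn_eq => e2.
    move=> /(_ (leq_trans (leq_addr _ _) e2)) e3.
    have := leq_mul e3 (leqnn D); rewrite -mulnA [(u D * D)%N]mulnC mulnA => e4.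
    have e5 := ltn_mod n D; rewrite D0 in e5.
    have := divn_eq n D => En; rewrite {1}En; nia.
  rewrite mulrBr lerBlDr -!natrM -natrD ler_nat; exact: e1.
have -> : ((u D)%:R / D%:R - eps / 2) * n%:R =
   ((u D)%:R * n%:R - D%:R * (n%:R * (eps / 2))) / D%:R :> R.
  by field; rewrite gt_eqF.
rewrite ler_pdivrMr //; apply: le_trans h1.
rewrite mulrBr lerB // [leLHS]mulrC.
by apply: ler_wpM2l nl; exact: ltW.
Unshelve. all: by end_near.
Qed.

End Fekete.

(** The maximal values are superadditive, by multiplying polynomials. *)
Lemma hat_mu_le_bound (k : closedFieldType) (R : realType) (nu : ratUV k -> int)
    (b : nat) : divisorial nu ->
  (forall d (f : polyUV k), f != 0 -> (msize f <= d.+1)%N -> nu (toK f) <= (d * b)%N%:Z) ->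
  hat_mu_le (b%:R : R) nu.
Proof.
move=> nu_div bound.
have toK0 (f : polyUV k) : f != 0 -> toK f != 0 by rewrite /toK tofrac_eq0.
pose V d (n : nat) := boolp.asbool (exists f : polyUV k,
  [/\ f != 0, (msize f <= d.+1)%N & nu (toK f) = n%:Z]).
have V0 d : exists n, V d n.
  exists 0%N; apply/boolp.asboolP; exists 1; rewrite oner_neq0 msize1 /toK rmorph1.
  by split => //; exact: (nu1 (divisorialC nu_div)).
have Vb d n : V d n -> (n <= d * b)%N.
  by move=> /boolp.asboolP[f [f0 fd En]]; have := bound d f f0 fd; rewrite En lez_nat.
pose mu d := ex_maxn (V0 d) (Vb d).
have muV d : V d (mu d) by rewrite /mu; case: ex_maxnP.
have mu_max d n : V d n -> (n <= mu d)%N.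
  by rewrite /mu; case: ex_maxnP => m _ mmax; exact: mmax.
have mu_add d e : (mu d + mu e <= mu (d + e))%N.
  apply: mu_max; have /boolp.asboolP[f1 [f10 fd1 E1]] := muV d.
  have /boolp.asboolP[f2 [f20 fd2 E2]] := muV e.
  apply/boolp.asboolP; exists (f1 * f2); split; first exact: mulf_neq0.
    by rewrite msizeM // -subn1 leq_subLR (leq_trans (leq_add fd1 fd2)) // addSn addnS.
  have -> : toK (f1 * f2) = toK f1 * toK f2 by rewrite /toK rmorphM.
  by rewrite (divisorialM nu_div (toK0 _ f10) (toK0 _ f20)) E1 E2.
have mu_b d : (mu d <= d * b)%N by exact: Vb (muV d).
have [l mul lb] := superadditive_cvg R mu_add mu_b.
exists l => //; exists (fun d => (mu d)%:Z) => // d d0; split.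
  by have /boolp.asboolP := muV d.
move=> f f0 fd; case En: (nu (toK f)) => [n|n] //.
by rewrite lez_nat; apply: mu_max; apply/boolp.asboolP; exists f.
Qed.

(** * From one point to very general valuations *)

Section SmallOrder.
Variables (k : closedFieldType) (S : hn_structure).
Local Notation K := (ratUV k).
Local Notation iota := (@cstK k).
Local Notation s := (hn_s S).
Local Notation g := (hn_g S).
Local Notation h := (hn_h S).
Local Notation mon := (generic_mon S k).

(** The combinations of the monomials of degree at most d in the generic u and v,
    specialised at a, have order at most n with respect to w_{s_g}. *)
Definition small_order (d n : nat) (a : 'I_(hn_b S) -> k) : Prop :=
  forall c : 'X_{1..2 < d.+1} -> k, (exists m, c m != 0) ->
  exists i l, (i <= n)%N /\ \sum_m c m * ((mon m)`_i`_l).@[a] != 0.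

Definition combination d a (c : 'X_{1..2 < d.+1} -> k) : {poly {poly k}} :=
  \sum_m (c m)%:P%:P * specialize a (mon m).

Lemma combination_coef d a (c : 'X_{1..2 < d.+1} -> k) i l :
  (combination a c)`_i`_l = \sum_m c m * ((mon m)`_i`_l).@[a].
Proof.
rewrite /combination !coef_sum; apply: eq_bigr => m _.
by rewrite !coefCM /specialize !coef_map.
Qed.

Lemma ev2_combination d a (c : 'X_{1..2 < d.+1} -> k) (w : nat -> K) :
  (forall i, (i <= s g)%N ->
     w i = row_tail (iota \o a) i (w i.+1) + w i.+1 ^+ h i * w i.+2) ->
  ev2 iota (w (s g).+1) (w (s g).+2) (combination a c) =
    \sum_m iota (c m) * (w 1%N ^+ (m ord0) * w 0%N ^+ (m ord_max)).
Proof.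
move=> row; rewrite rmorph_sum; apply: eq_bigr => m _.
by rewrite rmorphM /= ev2C ev1C (ev2_generic_mon _ row).
Qed.

Lemma small_order_open d n a0 : small_order d n a0 ->
  exists D : {mpoly k[hn_b S]}, D.@[a0] != 0 /\
    forall a, D.@[a] != 0 -> small_order d n a.
Proof.
move=> small0.
pose L := \max_(m : 'X_{1..2 < d.+1}) \max_(i < n.+1) size ((mon m)`_i)%R.
pose E (m : 'X_{1..2 < d.+1}) (il : 'I_n.+1 * 'I_L) := (mon m)`_il.1`_il.2.
have [c c0|D [D0 HD]] := @independence_open _ _ _ _ E a0.
  have [i [l [ni sum0]]] := small0 c c0.
  have [lL|Ll] := ltnP l L.
    by exists (Ordinal (ni : (i < n.+1)%N), Ordinal lL).
  case/eqP: sum0; rewrite big1 // => m _.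
  rewrite (@nth_default _ _ _ l) ?meval0 ?mulr0 //.
  apply: leq_trans Ll; rewrite /L.
  apply: leq_trans (leq_bigmax (F := fun m : 'X_{1..2 < d.+1} =>
    \max_(i < n.+1) size ((mon m)`_i)%R) m).
  exact: (leq_bigmax (F := fun i : 'I_n.+1 => size ((mon m)`_i)%R)
    (Ordinal (ni : (i < n.+1)%N))).
exists D; split=> // a Da c c0; have [[i l] sum0] := HD a Da c c0.
by exists i, l; split=> //; rewrite -ltnS.
Qed.

Lemma small_order_bound nu a w d n :
  divisorial nu -> hn_expansion nu a w -> small_order d n a ->
  forall f : polyUV k, f != 0 -> (msize f <= d.+1)%N -> nu (toK f) <= n%:Z.
Proof.
move=> nu_div hS small f f0 fd.
have [|i [l [ni Fil]]] := small (fun m => f@_m).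
  apply/existsP; apply: contraNT f0; rewrite negb_exists => /forallP c0.
  rewrite (mpolywE fd) big1 // => m _.
  by have := c0 m; rewrite negbK => /eqP ->; rewrite scale0r.
rewrite (toK_sum fd).
have Erow := w_row hS.
have := ev2_combination (fun m : 'X_{1..2 < d.+1} => f@_m) Erow.
case: (hS) => _ [-> ->] _ _ _ <-.
rewrite -combination_coef in Fil.
set F := combination _ _ in Fil *.
have Fi : F`_i != 0 by apply: contraNneq Fil => ->; rewrite coef0.
have := nu_ev2_le (divisorialM nu_div) (divisorialD nu_div) (divisorialC nu_div)
  (w_neq0 hS (leqnn _)) (w_gt0 hS (leqnn _)) (zg_transcendental nu_div hS) Fi ni.
by rewrite (nu_xg nu_div hS) mulr1.
Qed.

Lemma very_general_hat_mu (R : realType) G (b : nat) a0 :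
  hn_U a0 -> (forall d, small_order d (d * b) a0) ->
  very_general k S G (hat_mu_le (b%:R : R)).
Proof.
move=> Ua0 small0.
have [D HD] := boolp.choice (fun d => small_order_open (small0 d)).
pose lead : {mpoly k[hn_b S]} :=
  \prod_(j < (hn_g' S).+1 | (0 < j)%N) 'X_(tagnat.Rank j (ord0 : 'I_(hn_len j))).
have leadE a : lead.@[a] =
    \prod_(j < (hn_g' S).+1 | (0 < j)%N) @hn_coef k S a j ord0.
  by rewrite /lead rmorph_prod; apply: eq_bigr => j _; rewrite /= mevalXU.
exists (fun d => [set a | (D d * lead).@[a] != 0]%classic); split=> [d|].
  split.
  - exists [set D d * lead]%classic; apply/seteqP; split=> a /=.
      by move=> Da; exists (D d * lead).
    by case=> _ ->.
  - move=> a /=; rewrite mevalM mulf_eq0 negb_or => /andP[_].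
    by rewrite leadE => /prodf_neq0 + j j0; apply.
  exists a0; rewrite /= mevalM mulf_neq0 //; first by case: (HD d).
  by rewrite leadE; apply/prodf_neq0 => j j0; exact: Ua0.
move=> nu a w [nu_div _ _] hS Oa.
apply: (hat_mu_le_bound _ nu_div) => d f f0 fd.
apply: (small_order_bound nu_div hS) fd => //.
apply: (HD d).2; have := Oa d; rewrite /= mevalM mulf_eq0 negb_or.
by case/andP.
Qed.

End SmallOrder.

(** * The special point *)

Section BivariatePolynomial.
Variables (k : fieldType) (d : nat).
Implicit Type c : 'X_{1..2 < d.+1} -> k.

Definition bipoly c : {poly {poly k}} :=
  \sum_m (c m *: 'X^(m ord0))%:P * 'X^(m ord_max).

Lemma bmdeg2 (m : 'X_{1..2 < d.+1}) : (m ord0 + m ord_max <= d)%N.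
Proof.
have := bmdeg m; rewrite mdegE !big_ord_recl big_ord0 addn0.
by have -> : lift ord0 ord0 = ord_max :> 'I_2 by apply: val_inj.
Qed.

Lemma bipoly_coef c j i : (bipoly c)`_j`_i =
  \sum_m c m * ((i == m ord0) && (j == m ord_max))%:R.
Proof.
rewrite /bipoly !coef_sum; apply: eq_bigr => m _.
rewrite coefCM coefXn; case: (j == _); rewrite ?andbT ?andbF ?mulr0 ?coef0 //.
by rewrite mulr1 coefZ coefXn.
Qed.

Lemma bipoly_size c j : (size ((bipoly c)`_j)%R <= d.+1 - j)%N.
Proof.
apply/leq_sizeP => i ij; rewrite bipoly_coef big1 // => m _.
case: eqP => [Ei|_]; last by rewrite mulr0.
case: eqP => [Ej|_]; last by rewrite mulr0.
by have := bmdeg2 m; lia.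
Qed.

Lemma bipoly_neq0 c : (exists m, c m != 0) -> bipoly c != 0.
Proof.
case=> m0 cm0; apply: contraNneq cm0 => f0.
have := bipoly_coef c (m0 ord_max) (m0 ord0); rewrite f0 !coef0 (bigD1 m0) //= !eqxx.
rewrite mulr1 big1 ?addr0 => [->//|m mm0].
case: eqP => [E0|_]; last by rewrite mulr0.
case: eqP => [E1|_]; last by rewrite mulr0.
case/eqP: mm0; apply/val_inj/mnmP => i.
case: (unliftP ord0 i) => [i'|] -> //=.
by have -> : lift ord0 i' = ord_max :> 'I_2 by apply: val_inj; rewrite /= ord1.
Qed.

Lemma ev2_bipoly (K : fieldType) (iota : {rmorphism k -> K}) v u c :
  ev2 iota v u (bipoly c) =
    \sum_m iota (c m) * (u ^+ (m ord0) * v ^+ (m ord_max)).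
Proof.
rewrite rmorph_sum; apply: eq_bigr => m _.
by rewrite rmorphM rmorphXn /= ev2C ev2X ev1_monomial mulrA.
Qed.

End BivariatePolynomial.

Section SpecialPoint.
Variables (k : closedFieldType) (S : hn_structure) (nu : ratUV k -> int).
Variables (a0 : 'I_(hn_b S) -> k) (w0 : nat -> ratUV k).
Hypotheses (nu_div : divisorial nu) (hS : hn_expansion nu a0 w0).
Local Notation K := (ratUV k).
Local Notation iota := (@cstK k).
Local Notation s := (hn_s S).
Local Notation g := (hn_g S).
Local Notation h := (hn_h S).
Local Notation beta := (max_contact S nu w0).

Variable A : nat.
Hypothesis Ah : (A <= h 0)%N.

(** The coefficient of u^A in the first row is 1 and the others are 0; for A = 0 they
    are all 0. *)
Definition special_point (r : 'I_(hn_b S)) : k :=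
  if tagnat.sig1 r == ord0 then ((tagnat.sig2 r).+1 == A)%:R else a0 r.

(** The element that takes the place of v when the coefficients of the first row are
    those of [special_point]. *)
Definition special_v : K :=
  (0 < A)%N%:R * uK ^+ A + uK ^+ h 0%N * w0 2%N.

Definition special_w (i : nat) : K := if i is 0%N then special_v else w0 i.

Lemma special_pointE j l : special_point (tagnat.Rank j l) =
  if j == ord0 then (l.+1 == A)%:R else a0 (tagnat.Rank j l).
Proof. by rewrite /special_point tagnat.Rank2K /= tagnat.Rank1K. Qed.

Lemma special_point_U : hn_U special_point.
Proof.
move=> j j0; rewrite /hn_coef special_pointE.
have -> : (j == ord0) = false by apply/negbTE; rewrite -val_eqE /= -lt0n.
by case: (hS) => -[_ hU] _ _ _ _; exact: hU.
Qed.

Lemma special_row i : (i <= s g)%N ->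
  special_w i = row_tail (iota \o special_point) i (special_w i.+1)
                + special_w i.+1 ^+ h i * special_w i.+2.
Proof.
case: (hS) => -[[s0 _ k0 kh _] _] [_ w1] _ _ _.
have s_gt0 (j : 'I_(hn_g' S).+1) : (0 < j)%N -> (0 < s j)%N.
  move=> j0; rewrite -s0; apply: (hn_s_lt hS j0).
  exact: leq_trans (leq_ord j) (hn_g'_le S).
case: i => [_|i isg]; last first.
  rewrite /= (w_row hS isg); congr (_ + _).
  apply: eq_bigr => j /eqP sj; apply: eq_bigr => l _.
  rewrite /= special_pointE; case: eqP => // Ej.
  by rewrite Ej s0 in sj.
rewrite /= /special_v w1; congr (_ + _).
have h0 : (0 < h 0)%N by rewrite -{1}k0 -{2}s0 kh.
rewrite /row_tail (big_pred1 ord0) => [|j /=]; last first.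
  rewrite -val_eqE /=; case: (posnP j) => [->|j0]; first by rewrite s0.
  by rewrite (gtn_eqF (s_gt0 j j0)).
have lenE : @hn_len S ord0 = h 0 by rewrite /hn_len /= s0 k0 subn1 prednK.
have [A0|A0] := posnP A.
  rewrite mul0r big1 // => l _.
  by rewrite /= special_pointE eqxx A0 rmorph0 mul0r.
have lA : (A.-1 < @hn_len S ord0)%N by rewrite lenE prednK.
rewrite mul1r (bigD1 (Ordinal lA)) //= special_pointE eqxx /= prednK // eqxx.
rewrite rmorph1 mul1r k0 add1n prednK // big1 ?addr0 // => l lAn.
rewrite special_pointE eqxx; case: eqP => [El|_]; last by rewrite rmorph0 mul0r.
by case/eqP: lAn; apply: val_inj; rewrite /= -El.
Qed.

(** At the special point, u and v are specialised to u and [special_v] in the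
    original field, where [degree_value_bound] applies. *)
Lemma small_order_special b d : special_v != 0 -> nu special_v = b%:Z ->
  beta g.+1 <= b%:Z ^+ 2 -> small_order d (d * b) special_point.
Proof.
move=> v0 nuv betab c c0.
case: (hS) => _ [_ w1] _ _ _.
have nuM := divisorialM nu_div; have nuD := divisorialD nu_div.
have nuC := divisorialC nu_div.
have v'_in : alg2 iota uK special_v (uK ^+ h 0%N * w0 2%N).
  have -> : uK ^+ h 0%N * w0 2%N = special_v - iota (0 < A)%N%:R * uK ^+ A.
    by rewrite rmorph_nat /special_v addrAC subrr add0r.
  apply: alg2B; first exact: Alg2T.
  apply: Alg2M; first exact: Alg2C.
  apply: alg2X; exact: Alg2X.
have [N [N0 genN EN]] := generic_forms_expansion nu_div hS v'_in.
have Nb : (N <= b ^ 2)%N by rewrite -lez_nat -EN (le_trans betab) // -rmorphXn.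
have vu : vge nu 0 uK by right; rewrite -w1; apply/ltW/(w_gt0 hS).
apply: boolp.contrapT => no_coef.
suff : ((d * b).+1 <= d * b)%N by rewrite ltnn.
apply: (degree_value_bound nuM nuD nuC (w_neq0 hS (leqnn _)) (nu_xg nu_div hS)
   (zg_transcendental nu_div hS) N0 genN vu v0 nuv (bipoly_neq0 c0)) => //.
  exact: bipoly_size.
have := ev2_combination c special_row; rewrite /= w1 ev2_bipoly => <-.
have := vge_ev2 nuM nuD nuC (w_gt0 hS (leqnn _)) (zg_transcendental nu_div hS)
  (f := combination special_point c) (n := (d * b).+1).
rewrite (nu_xg nu_div hS) mulr1; apply => i; rewrite ltnS => ib.
apply/polyP => l; rewrite coef0 combination_coef.
by apply/eqP/negP => /negP cil; apply: no_coef; exists i, l.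
Qed.

End SpecialPoint.

(** * Values of the special line and conclusion *)

Section SpecialValues.
Variables (k : closedFieldType) (S : hn_structure) (nu : ratUV k -> int).
Variables (a0 : 'I_(hn_b S) -> k) (w0 : nat -> ratUV k).
Hypotheses (nu_div : divisorial nu) (hS : hn_expansion nu a0 w0).
Local Notation K := (ratUV k).
Local Notation iota := (@cstK k).
Local Notation s := (hn_s S).
Local Notation g := (hn_g S).
Local Notation h := (hn_h S).
Local Notation beta := (max_contact S nu w0).
Local Notation v' := (uK ^+ h 0%N * w0 2%N).

Let nuM := divisorialM nu_div.
Let nuD := divisorialD nu_div.
Let nuC := divisorialC nu_div.

Lemma uK_neq0 : uK != 0 :> K.
Proof. by case: (hS) => _ [_ <-] _ _ _; exact: (w_neq0 hS). Qed.

Lemma w2K_neq0 : w0 2%N != 0.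
Proof. exact: (w2_neq0 hS (leq0n _)). Qed.

Lemma v'_neq0 : v' != 0.
Proof. exact: (mulf_neq0 (expf_neq0 _ uK_neq0) w2K_neq0). Qed.

Lemma beta0E : beta 0%N = nu uK.
Proof. by case: (hS) => -[[s0 _ _ _ _] _] [_ w1] _ _ _; rewrite /= /hn_e s0 w1. Qed.

Lemma beta0_gt0 : 0 < beta 0%N.
Proof.
by rewrite beta0E; case: (hS) => _ [_ <-] _ _ _; exact: (w_gt0 hS).
Qed.

Lemma beta1E : beta 1%N = (h 0%N)%:Z * beta 0%N + nu (w0 2%N).
Proof.
case: (hS) => -[[s0 _ k0 kh _] _] _ _ _ _.
have h0 : (0 < h 0)%N by rewrite -{1}k0 -{2}s0 kh.
rewrite /= s0 k0 /hn_n mul1r; congr (_ + _).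
have -> : (h 0%N)%:Z = 1 + (h 0 - 1)%N%:Z by lia.
by rewrite mulrDl mul1r.
Qed.

Lemma nu_v' : nu v' = beta 1%N.
Proof.
by rewrite (nuM (expf_neq0 _ uK_neq0) w2K_neq0) (nuX nuM nuC _ uK_neq0) beta1E beta0E.
Qed.

Lemma beta1_gt0 : 0 < beta 1%N.
Proof.
case: (hS) => -[[s0 _ k0 kh _] _] _ _ _ _.
have h0 : (0 < h 0)%N by rewrite -{1}k0 -{2}s0 kh.
rewrite beta1E ltr_wpDr ?(w2_ge0 hS) // mulr_gt0 ?beta0_gt0 //.
Qed.

Lemma w2_value : (0 <= nu (w0 2%N) < beta 0%N)%R.
Proof.
rewrite (w2_ge0 hS) // beta0E.
by case: (hS) => _ [_ <-] _ [_ /(_ 0%N (leq0n _)) []].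
Qed.

Section Line.
Variable A : nat.
Hypotheses (A0 : (0 < A)%N) (Abeta : A%:Z <= (beta 1%N %/ beta 0%N)%Z).

Lemma A_beta0_le : A%:Z * beta 0%N <= beta 1%N.
Proof.
apply: le_trans _ (lez_floor (beta 1%N) (lt0r_neq0 beta0_gt0)).
by rewrite ler_wpM2r // ltW // beta0_gt0.
Qed.

Lemma A_le_h0 : (A <= h 0)%N.
Proof.
rewrite -ltnS -ltz_nat -(ltr_pM2r beta0_gt0); apply: le_lt_trans A_beta0_le _.
rewrite beta1E; have /andP[_] := w2_value.
by rewrite intS mulrDl mul1r addrC ltrD2r.
Qed.

Lemma special_line_value : special_v S w0 A != 0 /\
  nu (special_v S w0 A) = A%:Z * beta 0%N.
Proof.
have nuA : nu (uK ^+ A) = A%:Z * beta 0%N.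
  by rewrite (nuX nuM nuC _ uK_neq0) beta0E.
rewrite /special_v A0 mul1r -nuA.
have := A_beta0_le; rewrite le_eqVlt => /orP[/eqP EA|Alt]; last first.
  apply: (nu_add_gt nuM nuD nuC (expf_neq0 _ uK_neq0)).
  by right; rewrite nuA nu_v' -ltzD1 ltrD2r.
(* Equality forces A = h_0 and w_1 of value 0, hence s_g = 0. *)
have /andP[w2_ge w2_lt] := w2_value.
have EAh : A = h 0%N.
  apply/eqP; rewrite eqn_leq A_le_h0 -lez_nat -(ler_pM2r beta0_gt0).
  by rewrite EA beta1E lerDl.
have nw2 : nu (w0 2%N) = 0 by move: EA; rewrite EAh beta1E; lia.
have sg0 : s g = 0%N.
  case: (posnP (s g)) => // sg; have := w_gt0 hS sg; rewrite nw2 ltxx //.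
case: (hS) => _ _ _ _ [_ /(_ (- 1))]; rewrite sg0 rmorphN rmorph1 opprK => -[w20 nw20].
rewrite EAh; have -> : uK ^+ h 0%N + v' = uK ^+ h 0%N * (w0 2%N + 1) by ring.
split; first exact: (mulf_neq0 (expf_neq0 _ uK_neq0) w20).
by rewrite (nuM (expf_neq0 _ uK_neq0) w20) nw20 addr0.
Qed.

End Line.
End SpecialValues.

Theorem mainTheorem2 (k : closedFieldType) (R : realType)
  (G : dual_graph) (S : hn_structure)
  (nu0 : ratUV k -> int) (a0 : 'I_(hn_b S) -> k) (w0 : nat -> ratUV k)
  (hG : valuations_with_graph G nu0) (hm : ~ m_adic nu0)
  (hS : hn_expansion nu0 a0 w0)
  (hbeta : max_contact S nu0 w0 (hn_g S).+1 <= max_contact S nu0 w0 1 ^+ 2) :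
  very_general k S G (hat_mu_le ((max_contact S nu0 w0 1)%:~R : R)) /\
  (forall hA : exists a : nat, in_A S nu0 w0 a,
     very_general k S G
       (hat_mu_le ((max_contact S nu0 w0 0)%:~R * (ex_minn hA)%:R : R))).
Proof.
have nu_div : divisorial nu0 by case: hG.
split=> [|hA].
  have := beta1_gt0 hS; case Eb: (max_contact S nu0 w0 1) => [b|//] _.
  have Ev : special_v S w0 0 = uK ^+ hn_h S 0%N * w0 2%N.
    by rewrite /special_v mul0r add0r.
  apply: (very_general_hat_mu R G (special_point_U hS 0)) => d.
  apply: (small_order_special nu_div hS (leq0n _)); rewrite ?Ev -?Eb //.
    exact: (v'_neq0 hS).
  exact: (nu_v' nu_div hS).
case: ex_minnP => A /and3P[A0 Abeta Abeta2] _.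
have [v0 nuv] := special_line_value nu_div hS A0 Abeta.
have := beta0_gt0 hS; case Eb: (max_contact S nu0 w0 0) => [b|//] _.
rewrite Eb in Abeta2 nuv.
have -> : (b%:Z)%:~R * A%:R = (A * b)%N%:R :> R by rewrite natrM mulrC.
apply: (very_general_hat_mu R G (special_point_U hS A)) => d.
apply: (small_order_special nu_div hS (A_le_h0 hS Abeta)) => //.
by rewrite PoszM exprMn.
Qed.
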